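(* (i) For every irrational $\alpha\in[0,1)$, $\dim_{\rm H}(\Omega_\alpha(1,1))\le\frac{2}{w(\alpha)+1}$. (ii) Let $\alpha\in[0,1)\setminus\mathbb{Q}$ satisfy $\liminf_{k\to\infty}\frac{\log q_{k+1}}{\log q_k}>1$, where $q_k=q_k(\alpha)$ is the denominator of the $k$-th convergent of the continued fraction expansion of $\alpha$. Then $\dim_{\rm H}(\Omega_\alpha(1,1))=\frac{1}{w(\alpha)+1}$.
   Context: For $x\in\mathbb{R}$, $\langle x\rangle$ denotes the distance from $x$ to the nearest integer. ''Decreasing'' means non-increasing. $\mathcal{D}$ is the set of decreasing functions $\psi:\mathbb{N}\to[0,\infty)$ with $\sum_{q\ge1}\psi(q)=\infty$. For $\psi:\mathbb{N}\to[0,\infty)$, $W_{1,1}(\psi)$ is the set of $(\alpha,\gamma)\in[0,1)^2$ such that $\langle q\alpha-\gamma\rangle<\psi(|q|)$ for infinitely many $q\in\mathbb{Z}$. $\Omega_\alpha(1,1)=\{\gamma\in[0,1):(\alpha,\gamma)\in W_{1,1}(\psi)\text{ for all }\psi\in\mathcal{D}\}$. For irrational $\alpha$, $w(\alpha)=\sup\{s>0:\langle q\alpha\rangle<q^{-s}\text{ for infinitely many }q\in\mathbb{N}\}$ (irrationality exponent). $\dim_{\rm H}$ is Hausdorff dimension. *)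

(* Defs.v *)
From HB Require Import structures.
From mathcomp Require Import all_boot all_order all_algebra.
From mathcomp Require Import all_classical all_reals all_analysis.
Set Implicit Arguments. Unset Strict Implicit. Unset Printing Implicit Defensive.
Import Order.TTheory GRing.Theory Num.Theory.
Import numFieldNormedType.Exports.
Local Open Scope classical_set_scope.
Local Open Scope ring_scope.

Section Defs.
Variable R : realType.

Definition dnint (x : R) : R :=
  Num.min (x - (Num.floor x)%:~R) ((Num.ceil x)%:~R - x).


(* The class D: decreasing psi : N -> [0,oo) with divergent sum.
   N = {1,2,...}; the value psi 0 plays no role. *)
Definition classD (psi : nat -> R) : Prop :=
  (forall q, (1 <= q)%N -> 0 <= psi q) /\
  (forall m n, (1 <= m)%N -> (m <= n)%N -> psi n <= psi m) /\
  ([sequence \sum_(1 <= k < n) psi k]_n @ \oo --> +oo).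

Definition W11 (psi : nat -> R) : set (R * R) :=
  [set ag | 0 <= ag.1 < 1 /\ 0 <= ag.2 < 1 /\
     infinite_set [set q : int | dnint (q%:~R * ag.1 - ag.2) < psi `|q|%N]].

Definition Omega11 (alpha : R) : set R :=
  [set g | 0 <= g < 1 /\ forall psi, classD psi -> W11 psi (alpha, g)].

Definition irr_exp (alpha : R) : \bar R :=
  ereal_sup [set s%:E | s in [set s : R | 0 < s /\
     infinite_set [set q : nat | (0 < q)%N /\ dnint (q%:R * alpha) < q%:R `^ (- s)]]].

(* diameter of a subset of R (the sup is -oo for the empty set) *)
Definition ediam (A : set R) : \bar R :=
  ereal_sup [set `|x - y|%:E | x in A & y in A].

Definition hausdorff_delta (s delta : R) (E : set R) : \bar R :=
  ereal_inf [set v | exists U : nat -> set R,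
     E `<=` \bigcup_i U i /\ (forall i, (ediam (U i) <= delta%:E)%E) /\
     v = (\sum_(0 <= i <oo) ((fine (ediam (U i))) `^ s)%:E)%E].

Definition hausdorff_measure (s : R) (E : set R) : \bar R :=
  ereal_sup [set hausdorff_delta s d E | d in [set d : R | 0 < d]].

Definition dimH (E : set R) : \bar R :=
  ereal_inf [set s%:E | s in [set s : R | 0 < s /\ hausdorff_measure s E = 0%E]].

(* c / (w + 1) for an extended real w >= 1, with the convention c/(oo+1) = 0 *)
Definition div_w1 (c : R) (w : \bar R) : \bar R :=
  match w with
  | EFin r => (c / (r + 1))%:E
  | _ => 0%E
  end.

Fixpoint cf_t (alpha : R) (k : nat) : R :=
  match k with
  | 0 => alpha
  | k'.+1 => let t := cf_t alpha k' in t^-1 - (Num.floor (t^-1))%:~R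
  end.

Definition cf_a (alpha : R) (k : nat) : R :=
  (Num.floor ((cf_t alpha k.-1)^-1))%:~R.

(* (q_{k-1}, q_k), with q_{-1} = 0, q_0 = 1, q_k = a_k q_{k-1} + q_{k-2} *)
Fixpoint cf_qpair (alpha : R) (k : nat) : R * R :=
  match k with
  | 0 => (0, 1)
  | k'.+1 => let pq := cf_qpair alpha k' in
             (pq.2, cf_a alpha k'.+1 * pq.2 + pq.1)
  end.

Definition cf_q (alpha : R) (k : nat) : R := (cf_qpair alpha k).2.

End Defs.

(* Main.v *)
Require Import Defs.
From HB Require Import structures.
From mathcomp Require Import all_boot all_order all_algebra.
From mathcomp Require Import all_classical all_reals all_analysis.
From mathcomp Require Import zify ring lra.
Import Order.TTheory GRing.Theory Num.Theory.
Import numFieldNormedType.Exports.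
Local Open Scope classical_set_scope.
Local Open Scope ring_scope.
Set Implicit Arguments. Unset Strict Implicit. Unset Printing Implicit Defensive.

(* Write ||x|| for the distance to the nearest integer and q_k for the
   denominators of the convergents.  Testing against
   psi(n) = min_(|q| <= n) ||q alpha - g|| shows that every g in Omega satisfies,
   for all large N, ||n alpha - g|| < 1/N for some |n| <= N.  Take
   N = sqrt(q_k q_(k+1)): reducing n modulo q_k moves n alpha by at most about
   N / (q_k q_(k+1)) = 1/N, so g is within 4/N of one of the q_k points j alpha,
   0 <= j < q_k.  One good scale gives the bound 2/(w+1).  In the lacunary case
   all scales are used: since the points j alpha, j < q_(k+1), are 1/(2 q_(k+1))
   separated, only about sqrt(q_(k+1)/q_k) of them are near a given point of the
   previous scale, hence about sqrt(q_k) balls of radius (q_k q_(k+1))^(-1/2)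
   suffice, which gives 1/(w+1).

   For the lower bound take g = alpha + sum_k m_k (q_k alpha - p_k) with
   1 <= m_k <= y_k + 1 and y_k = q_k^(-theta) (q_(k+1)/q_k)^(1/2).  The partial sums
   are points j_k alpha with j_k <= q_k, and they approximate g so well that
   sum_k j_(k+1) ||j_k alpha - g|| < oo, whence g is in Omega.  A cover of this
   Cantor set of small t-weight would have total mass < 1 for the uniform measure
   on digits; following a child along which this mass does not increase produces a
   point of the Cantor set outside the cover. *)

(** * Null sets for Hausdorff measures *)

Section Hausdorff.
Variable R : realType.
Implicit Types (s t : R) (E : set R).

(* No bound on the radii is imposed: one term of the sum bounds its radius. *)
Definition hnull s E := forall e : R, 0 < e -> exists c r : nat -> R,
  [/\ forall i, 0 <= r i, forall x, E x -> exists i, `|x - c i| <= r i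
    & (\esum_(i in [set: nat]) (r i `^ s)%:E <= e%:E)%E].

(** The [n]-th set is covered with weight [e / 2 ^ n.+1], and a bijection of [nat] with pairs merges
    the covers into one sequence. *)
Lemma hnull_bigcup s (E : nat -> set R) :
  (forall n, hnull s (E n)) -> hnull s (\bigcup_n E n).
Proof.
move=> H e e0.
have /choice[cr Hcr] : forall n, exists cr : (nat -> R) * (nat -> R),
    [/\ forall i, 0 <= cr.2 i, forall x, E n x -> exists i, `|x - cr.1 i| <= cr.2 i
    & (\esum_(i in [set: nat]) (cr.2 i `^ s)%:E <= (e / (2 ^ n.+1)%:R)%:E)%E].
  move=> n; have [|c [r crP]] := H n (e / (2 ^ n.+1)%:R).
    by rewrite divr_gt0// ltr0n expn_gt0.
  by exists (c, r).
have /card_esym/ppcard_eqP[f] := card_nat2.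
exists (fun k => (cr (f k).1).1 (f k).2), (fun k => (cr (f k).1).2 (f k).2); split.
- by move=> i; have [] := Hcr (f i).1.
- move=> x [n _ Enx]; have [_ /(_ _ Enx)[i xi] _] := Hcr n.
  by exists (f^-1%FUN (n, i)); rewrite invK ?inE.
rewrite -(@reindex_esum _ _ _ setT setT f (fun p => ((cr p.1).2 p.2 `^ s)%:E))//.
rewrite (_ : setT = setT `*`` (fun=> setT)); last by apply/seteqP; split.
rewrite -(@esum_esum _ _ _ _ _ (fun i j => ((cr i).2 j `^ s)%:E)); last first.
  by move=> i j _ _; rewrite lee_fin powR_ge0.
rewrite -nneseries_esumT; last first.
  by move=> n; apply: esum_ge0 => i _; rewrite lee_fin powR_ge0.
apply: le_trans (@epsilon_trick0 R e predT (ltW e0)); apply: lee_nneseries => //.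
  by move=> i _ _; apply: esum_ge0 => j _; rewrite lee_fin powR_ge0.
by move=> n _; have [] := Hcr n.
Qed.

Lemma hnull_sub s E E' : E `<=` E' -> hnull s E' -> hnull s E.
Proof.
move=> sub H e e0; have [c [r [r0 cE S]]] := H e e0.
by exists c, r; split => // x /sub; exact: cE.
Qed.

(** The list is padded to a sequence by balls of radius 0, which cost nothing: 0 to the power [s] is
    0 because [s != 0]. *)
Lemma hnull_fin s E : s != 0 ->
  (forall e, 0 < e -> exists (l : seq R) (r : R), [/\ 0 <= r,
     forall x, E x -> exists2 c, c \in l & `|x - c| <= r
   & (size l)%:R * r `^ s <= e]) -> hnull s E.
Proof.
move=> s0 H e e0; have [l [r [r0 lE S]]] := H e e0.
exists (nth 0 l), (fun i => if (i < size l)%N then r else 0); split.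
- by move=> i; case: ifP.
- move=> x /lE[c cl xc]; exists (index c l).
  by rewrite nth_index// index_mem cl.
rewrite -nneseries_esumT; last by move=> n; rewrite lee_fin powR_ge0.
rewrite (@nneseries_split _ _ _ (size l)); last first.
  by move=> n _; rewrite lee_fin powR_ge0.
rewrite [X in (_ + X)%E]eseries0 ?adde0; last first.
  by move=> i /=; rewrite add0n => il _; rewrite ltnNge il /= powR0.
rewrite big_mkord (eq_bigr (fun=> (r `^ s)%:E)); last first.
  by move=> i _; rewrite ltn_ord.
by rewrite sumEFin lee_fin sumr_const card_ord -mulr_natl.
Qed.

Lemma hausdorff_delta_ge0 s d E : (0 <= hausdorff_delta s d E)%E.
Proof.
apply: le_ereal_inf_tmp => _ [U [_ [_ ->]]].
by apply: nneseries_ge0 => n _ _; rewrite lee_fin powR_ge0.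
Qed.

Lemma hnull_hausdorff s E : 0 < s -> hnull s E -> hausdorff_measure s E = 0%E.
Proof.
move=> s0 H; apply/eqP; rewrite eq_le; apply/andP; split; last first.
  apply: le_trans (hausdorff_delta_ge0 s 1 E) _.
  by apply: ereal_sup_ubound; exists 1 => //=.
apply: ge_ereal_sup => _ [d /= d0 <-].
apply/lee_addgt0Pr => e e0; rewrite add0e.
have C0 : 0 < 2 `^ s :> R by rewrite powR_gt0.
(* The first bound pays for the factor 2 between radius and diameter; the second makes every radius
   at most [d / 2], since one term is at most the sum. *)
have [|c [r [r0 cE S]]] := H (Num.min (e / 2 `^ s) ((d / 2) `^ s)).
  by rewrite lt_min divr_gt0//= powR_gt0// divr_gt0.
pose B i := [set x : R | `|x - c i| <= r i].
have B_ge0 i : (0 <= ediam (B i))%E.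
  by apply: ereal_sup_ubound; exists (c i); first (by rewrite /B /= subrr normr0);
    exists (c i); rewrite ?subrr ?normr0// /B /= subrr normr0.
have B_le i : (ediam (B i) <= (2 * r i)%:E)%E.
  apply: ge_ereal_sup => _ [x /= xB [y /= yB <-]]; rewrite lee_fin.
  move: xB yB; rewrite /B /= !ler_norml => /andP[? ?] /andP[? ?].
  by apply/andP; split; lra.
have fineB i : 0 <= fine (ediam (B i)) <= 2 * r i.
  by have := B_ge0 i; have := B_le i; case: (ediam _) => //= u;
    rewrite !lee_fin => -> ->.
have Sr i : ((r i `^ s)%:E <= ((d / 2) `^ s)%:E)%E.
  apply: le_trans (le_trans S _); last by rewrite lee_fin ge_min lexx orbT.
  rewrite -nneseries_esumT; last by move=> n; rewrite lee_fin powR_ge0.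
  rewrite (@nneseriesD1 _ _ i)//; last by move=> n _; rewrite lee_fin powR_ge0.
  by rewrite leeDl// nneseries_ge0// => n _ _; rewrite lee_fin powR_ge0.
apply: (@le_trans _ _
    (\sum_(0 <= i <oo) ((fine (ediam (B i))) `^ s)%:E)%E).
  apply: ereal_inf_lbound; exists B; split; [|split => //].
    by move=> x /cE[i xi]; exists i.
  move=> i; apply: le_trans (B_le i) _; rewrite lee_fin.
  have := Sr i; rewrite lee_fin => Sri.
  suff : r i <= d / 2 by lra.
  rewrite leNgt; apply/negP => rid.
  have : (d / 2) `^ s < r i `^ s.
    by apply: gt0_ltr_powR; rewrite ?nnegrE ?r0 ?divr_ge0// ?ltW.
  by rewrite ltNge Sri.
apply: (@le_trans _ _ (\sum_(0 <= i <oo) ((2 `^ s)%:E * (r i `^ s)%:E)%E)%E).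
  apply: lee_nneseries => [i _ _|i _]; first by rewrite lee_fin powR_ge0.
  rewrite -EFinM lee_fin -powRM//; have /andP[f0 f1] := fineB i.
  by apply: ge0_ler_powR; rewrite ?nnegrE ?(ltW s0) ?f0 ?mulr_ge0.
rewrite nneseriesZl; last by move=> i _; rewrite lee_fin powR_ge0.
apply: (@le_trans _ _ ((2 `^ s)%:E * (e / 2 `^ s)%:E)%E).
  apply: lee_wpmul2l; first by rewrite lee_fin powR_ge0.
  rewrite nneseries_esumT; last by move=> n; rewrite lee_fin powR_ge0.
  by apply: le_trans S _; rewrite lee_fin ge_min lexx.
by rewrite -EFinM mulrC divfK// gt_eqF.
Qed.

(** Scale 1 suffices: no diameter is then +oo, and that of an empty set, -oo, has [fine] equal to 0,
    so real bounds [d i] can be extracted. *)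
Lemma hausdorff_cover s E e : hausdorff_measure s E = 0%E -> 0 < e ->
  exists (U : nat -> set R) (d : nat -> R),
  [/\ E `<=` \bigcup_i U i, forall i, 0 <= d i,
      forall i x y, U i x -> U i y -> `|x - y| <= d i
    & (\sum_(0 <= i <oo) (d i `^ s)%:E < e%:E)%E].
Proof.
move=> H e0; have : (hausdorff_delta s 1 E < e%:E)%E.
  apply: (@le_lt_trans _ _ 0%E); last by rewrite lte_fin.
  by rewrite -H; apply: ereal_sup_ubound; exists 1 => //=.
move=> /ereal_inf_lt[_ [U [EU [dU ->]]] Ue].
exists U, (fun i => fine (ediam (U i))); split => //.
  move=> i; have [[x Ux]|] := pselect (U i !=set0); last first.
    move=> /set0P/negP; rewrite negbK => /eqP ->.
    rewrite /ediam (_ : [set _ | _ in _ & _ in _] = set0) ?ereal_sup0//.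
    by apply/seteqP; split => // y [].
  have : (0 <= ediam (U i))%E.
    by apply: ereal_sup_ubound; exists x => //; exists x => //; rewrite subrr normr0.
  by have := dU i; case: (ediam _).
move=> i x y Ux Uy.
have : (`|x - y|%:E <= ediam (U i))%E.
  by apply: ereal_sup_ubound; exists x => //; exists y.
by have := dU i; case: (ediam _).
Qed.

End Hausdorff.

(** * Continued fractions *)

Section DistanceToIntegers.
Variable R : realType.
Implicit Types (x : R) (p : int).

Lemma dnint_ge0 x : 0 <= dnint x.
Proof. by rewrite le_min !subr_ge0 floor_le ceil_ge. Qed.

Lemma dnint_le x p : dnint x <= `|x - p%:~R|.
Proof.
rewrite ge_min; have [xp|px] := leP x p%:~R.
  apply/orP; right; rewrite ler0_norm ?subr_le0// opprB lerB//.
  by rewrite ler_int ceil_le_int.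
apply/orP; left; rewrite gtr0_norm ?subr_gt0// lerB//.
by rewrite ler_int floor_ge_int ltW.
Qed.

Lemma dnint_attained x : exists p, `|x - p%:~R| = dnint x.
Proof.
rewrite /dnint; have [_|_] := leP (x - (Num.floor x)%:~R) ((Num.ceil x)%:~R - x).
  by exists (Num.floor x); rewrite ger0_norm// subr_ge0 floor_le.
by exists (Num.ceil x); rewrite ler0_norm ?opprB// subr_le0 ceil_ge.
Qed.

End DistanceToIntegers.

Section ContinuedFraction.
Variable R : realType.
Implicit Types alpha : R.

(** The determinant is squared so that its alternating sign need not be tracked. *)
Record convergents alpha (Q P : nat -> nat) : Prop := Convergents {
  conv_gt0 : forall k, (0 < Q k)%N;
  conv_le : forall k, (Q k <= Q k.+1)%N;
  conv_ge : forall k, (k <= Q k)%N;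
  conv_det : forall k,
    ((Q k)%:Z * (P k.+1)%:Z - (Q k.+1)%:Z * (P k)%:Z) ^+ 2 = 1;
  conv_ub : forall k, `|(Q k)%:R * alpha - (P k)%:R| < (Q k.+1)%:R^-1;
  conv_lb : forall k, (2 * (Q k.+1)%:R)^-1 <= `|(Q k)%:R * alpha - (P k)%:R| }.

Lemma irrational_cf_t alpha k : irrational alpha -> irrational (cf_t alpha k).
Proof.
move=> irr; elim: k => //= k IH [u _ uE]; apply: IH.
exists ((u + (Num.floor (cf_t alpha k)^-1)%:~R)^-1) => //.
by rewrite fmorphV rmorphD/= uE ratr_int subrK invrK.
Qed.

Lemma irrational_neq0 alpha : irrational alpha -> alpha != 0.
Proof. by move=> irr; apply/eqP => a0; apply: irr; exists 0; rewrite ?rmorph0. Qed.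

Lemma cf_t_itv alpha k : 0 <= alpha < 1 -> irrational alpha ->
  0 < cf_t alpha k < 1.
Proof.
move=> a01 irr; have := irrational_neq0 (@irrational_cf_t _ k irr).
rewrite lt0r => -> /=; case: k => [//|k] /=.
by rewrite subr_ge0 floor_le /= ltrBlDl; have := floorD1_gt (cf_t alpha k)^-1; rewrite intrD1.
Qed.

(* Consecutive denominators for (u, v) = (0, 1), numerators for (1, 0). *)
Fixpoint cf_rec alpha (u v : nat) k : nat * nat :=
  if k is k'.+1 then
    let w := cf_rec alpha u v k' in
    (w.2, (absz (Num.floor (cf_t alpha k')^-1) * w.2 + w.1)%N)
  else (u, v).

Lemma cf_partial_quotient alpha k : 0 <= alpha < 1 -> irrational alpha ->
  (0 < absz (Num.floor (cf_t alpha k)^-1))%N /\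
  (absz (Num.floor (cf_t alpha k)^-1))%:R = (Num.floor (cf_t alpha k)^-1)%:~R :> R.
Proof.
move=> a01 irr; have /andP[t0 t1] := cf_t_itv k a01 irr.
have : 1 <= Num.floor (cf_t alpha k)^-1.
  by rewrite floor_ge_int invf_ge1// ltW.
by case: (Num.floor _) => // n; rewrite lez_nat.
Qed.

Lemma cf_qpairE alpha k : 0 <= alpha < 1 -> irrational alpha ->
  cf_qpair alpha k =
  ((cf_rec alpha 0 1 k).1%:R, (cf_rec alpha 0 1 k).2%:R).
Proof.
move=> a01 irr; elim: k => //= k ->; congr pair => /=.
by rewrite natrD natrM (cf_partial_quotient k a01 irr).2.
Qed.

(** With t = [cf_t alpha k], the first identity is alpha = (p_k + t p_(k-1)) / (q_k + t q_(k-1))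
    rearranged. Since 0 < t < 1 and q_(k-1) <= q_k, the second places |q_(k-1) alpha - p_(k-1)|
    between 1/(2 q_k) and 1/q_k. *)
Lemma cf_rec_inv alpha k : 0 <= alpha < 1 -> irrational alpha ->
  let q := cf_rec alpha 0 1 k in let p := cf_rec alpha 1 0 k in
  let d' := q.1%:R * alpha - p.1%:R in
  [/\ q.2%:R * alpha - p.2%:R = - (cf_t alpha k * d'),
      `|d'| * (q.2%:R + cf_t alpha k * q.1%:R) = 1,
      (0 < q.2)%N /\ (q.1 <= q.2)%N
    & (q.1%:Z * p.2%:Z - q.2%:Z * p.1%:Z) ^+ 2 = 1].
Proof.
move=> a01 irr; elim: k => [|k] /=.
  by split=> //; rewrite !(mul0r, mulr0, mul1r, addr0, sub0r, subr0, mulrN, opprK, mulr1, normrN1).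
move: (cf_rec alpha 0 1 k) (cf_rec alpha 1 0 k) => [q' q] [p' p] /= [E1 E2 [q0 q'q] E3].
have /andP[t0 t1] := cf_t_itv k a01 irr.
have [] := cf_partial_quotient k a01 irr.
set a := absz _ => a0 <-; set t := cf_t alpha k in t0 t1 E1 E2 *.
have tN0 : t != 0 by rewrite gt_eqF.
have E1' : q'%:R * alpha - p'%:R = - (t^-1 * (q%:R * alpha - p%:R)).
  by rewrite E1 mulrN opprK mulKf.
split.
- rewrite !natrD !natrM -[LHS]/(_ * _ - _).
  have -> : (a%:R * q%:R + q'%:R) * alpha - (a%:R * p%:R + p'%:R) =
    a%:R * (q%:R * alpha - p%:R) + (q'%:R * alpha - p'%:R) by ring.
  by rewrite E1'; ring.
- rewrite E1 normrN normrM (gtr0_norm t0) natrD natrM -[RHS]E2.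
  by field.
- split; first by rewrite addn_gt0 muln_gt0 a0 q0.
  by apply: leq_trans (leq_addr _ _); rewrite leq_pmull.
- by rewrite -E3 !PoszD !PoszM; ring.
Qed.

Lemma cf_convergents alpha : 0 <= alpha < 1 -> irrational alpha ->
  exists Q P, convergents alpha Q P /\ forall k, cf_q alpha k = (Q k)%:R.
Proof.
move=> a01 irr; exists (fun k => (cf_rec alpha 0 1 k).2), (fun k => (cf_rec alpha 1 0 k).2).
have inv k := cf_rec_inv k a01 irr.
split; last by move=> k; rewrite /cf_q cf_qpairE.
have Q0 k : (0 < (cf_rec alpha 0 1 k).2)%N by have [_ _ []] := inv k.
have Q1 k : (0 < (cf_rec alpha 0 1 k.+1).1)%N by exact: Q0.
have QD k : ((cf_rec alpha 0 1 k).2 + (cf_rec alpha 0 1 k).1 <= (cf_rec alpha 0 1 k.+1).2)%N.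
  by rewrite /= leq_add2r leq_pmull// (cf_partial_quotient k a01 irr).1.
have Db k : let q := (cf_rec alpha 0 1 k.+1).2%:R in
  let d := `|(cf_rec alpha 0 1 k).2%:R * alpha - (cf_rec alpha 1 0 k).2%:R| in
  d * q < 1 /\ 1 <= 2 * (d * q).
  move=> q d; have [_ E _ _] := inv k.+1; have /andP[t0 t1] := cf_t_itv k.+1 a01 irr.
  have [_ _ [_ q'q] _] := inv k.+1.
  rewrite -/q -/d in E; set q' : R := ((cf_rec alpha 0 1 k.+1).1)%:R in E.
  have q'0 : 0 < q' by rewrite ltr0n.
  have qq' : q' <= q by rewrite ler_nat.
  have d0 : 0 < d.
    by rewrite lt0r normr_ge0 andbT; apply/eqP => d0; move: E; rewrite d0 mul0r => /esym/eqP; rewrite oner_eq0.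
  set t := cf_t alpha k.+1 in E t0 t1.
  have h1 : 0 < d * (t * q') by rewrite !mulr_gt0.
  have h2 : d * (t * q') <= d * q.
    by rewrite ler_pM2l//; apply: le_trans qq'; rewrite ler_piMl// ltW.
  by split; lra.
split=> //.
- by move=> k; have [_ _ []] := inv k.+1.
(* Strict growth starts only at index 1, as Q 0 = Q 1 = 1 is possible; hence the induction on two
   consecutive indices. *)
- move=> k; suff : (k <= (cf_rec alpha 0 1 k).2)%N /\ (k.+1 <= (cf_rec alpha 0 1 k.+1).2)%N by case.
  elim: k => [|k [h1 h2]]; first by split=> //; exact: Q0.
  split=> //; apply: leq_trans (QD k.+1).
  by rewrite -addn1 leq_add// Q1.
- by move=> k; have [_ _ _] := inv k.+1.
- move=> k; have [h _] := Db k; rewrite -[ltRHS]mul1r ltr_pdivlMr// ltr0n; exact: Q0.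
- move=> k; have [_ h] := Db k.
  have q0 : 0 < 2 * (cf_rec alpha 0 1 k.+1).2%:R :> R by rewrite mulr_gt0// ltr0n Q0.
  by rewrite -[leLHS]mul1r ler_pdivrMr// mulrCA.
Qed.

(* The integers j P - p Q at the indices k.+1 and k cannot both vanish, since by
   [conv_det] the second one is +-j / Q k.+1 when the first one is 0. *)
Lemma convergents_sep alpha Q P k : convergents alpha Q P ->
  (2 * Q k.+1 <= Q k.+2)%N -> forall j p : int, j != 0 -> (absz j < Q k.+1)%N ->
  (2 * (Q k.+1)%:R)^-1 <= `|j%:~R * alpha - p%:~R|.
Proof.
move=> cv Qk j p j0 jQ.
have Q0 : 0 < (Q k.+1)%:R :> R by rewrite ltr0n (conv_gt0 cv).
have [E|NE] := eqVneq (j * (P k.+1)%:Z) ((Q k.+1)%:Z * p).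
  have := conv_det cv k.
  set e := (_ - _) => /eqP; rewrite sqrf_eq1 => eE.
  have : (Q k.+1)%:Z * (j * (P k)%:Z - (Q k)%:Z * p) = - j * e.
    rewrite /e mulrBr [(Q k.+1)%:Z * ((Q k)%:Z * p)]mulrCA -E; ring.
  move=> /(congr1 absz); rewrite !abszM abszN absz_nat.
  have -> : absz e = 1%N by case/orP: eE => /eqP ->.
  rewrite muln1; case: (absz (_ - _)) => [|m] h.
    by move: j0; rewrite -absz_eq0 -h muln0.
  by move: jQ; rewrite -h mulnS ltnNge leq_addr.
rewrite -[leLHS]mul1r ler_pdivrMr ?mulr_gt0//.
have h1 : 1 <= `|j%:~R * (P k.+1)%:R - (Q k.+1)%:R * p%:~R| :> R.
  have -> : j%:~R * (P k.+1)%:R - (Q k.+1)%:R * p%:~R =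
    (j * (P k.+1)%:Z - (Q k.+1)%:Z * p)%:~R :> R by rewrite intrB !intrM.
  by rewrite -intr_norm ler1z -gtz0_ge1 normr_gt0 subr_eq0.
have E : j%:~R * (P k.+1)%:R - (Q k.+1)%:R * p%:~R =
   (Q k.+1)%:R * (j%:~R * alpha - p%:~R) - j%:~R * ((Q k.+1)%:R * alpha - (P k.+1)%:R) by ring.
(* By [2 * Q k.+1 <= Q k.+2] this error takes at most half of the nonzero integer in [h1]; the other
   half is left for [Q k.+1] times the distance sought. *)
have h2 : `|j%:~R * ((Q k.+1)%:R * alpha - (P k.+1)%:R)| <= 2^-1.
  rewrite normrM; apply: (@le_trans _ _ ((Q k.+1)%:R * (2 * (Q k.+1)%:R)^-1)); last first.
    by rewrite invfM mulrCA divff ?gt_eqF// mulr1.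
  apply: ler_pM => //; first by rewrite -intr_norm -abszE ler_nat ltnW.
  apply: (le_trans (ltW (conv_ub cv k.+1))).
  rewrite lef_pV2 ?posrE ?mulr_gt0 ?ltr0n ?(conv_gt0 cv)//.
  by rewrite -natrM ler_nat.
rewrite E in h1; have := ler_normB ((Q k.+1)%:R * (j%:~R * alpha - p%:~R)) (j%:~R * ((Q k.+1)%:R * alpha - (P k.+1)%:R)).
rewrite normrM (gtr0_norm Q0); lra.
Qed.

End ContinuedFraction.

(** * Uniform approximation *)

Lemma unbounded_infinite (T : eqType) (f : T -> nat) (A : set T) :
  (forall B : nat, exists2 x, A x & (B <= f x)%N) -> infinite_set A.
Proof.
move=> H /finite_seqP[s As].
have [x Ax] := H (\max_(x <- s) f x).+1.
rewrite leqNgt ltnS => /negP; apply; apply: leq_bigmax_seq => //.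
by move: Ax; rewrite As.
Qed.

Section UniformApproximation.
Variable R : realType.
Implicit Types (alpha g s t : R).

Lemma infinite_nat_ge (A : set nat) : infinite_set A ->
  forall N, exists2 n, A n & (N <= n)%N.
Proof.
move=> infA N; apply: contrapT => /forall2NP H; apply: infA.
apply: (@sub_finite_set _ _ `I_N) => // n An.
by case: (H n) => //= /negP; rewrite -ltnNge.
Qed.

Lemma expR_eventually_small (C c e : R) : 0 < c -> 0 < e ->
  exists A, forall a, A <= a -> C * expR (- (c * a)) <= e.
Proof.
move=> c0 e0; exists (C / e / c) => a ha.
rewrite expRN ler_pdivrMr ?expR_gt0//.
apply: le_trans (ler_wpM2l (ltW e0) (expR_ge1Dx _)).
rewrite -ler_pdivrMl// mulrC; move: ha; rewrite ler_pdivrMr// => ha.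
by apply: le_trans ha _; rewrite mulrC lerDr.
Qed.

(** The starting scale [N0] is a parameter so that Omega is covered by countably many of these
    sets. *)
Definition uniformly_approximable alpha N0 : set R :=
  [set g | 0 <= g < 1 /\ forall N, (N0 <= N)%N -> (0 < N)%N ->
     exists2 n : int, (absz n <= N)%N & dnint (n%:~R * alpha - g) < N%:R^-1].

Fixpoint symmetric_min (d : int -> R) n :=
  if n is n'.+1 then
    Num.min (symmetric_min d n') (Num.min (d n) (d (- n%:Z)))
  else d 0.

Lemma symmetric_min_le d n q : (absz q <= n)%N -> symmetric_min d n <= d q.
Proof.
elim: n => [|n IH] /= qn.
  by move: qn; rewrite leqn0 absz_eq0 => /eqP ->.
rewrite !ge_min; move: qn; rewrite leq_eqVlt => /predU1P[qn|]; last first.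
  by rewrite ltnS => /IH ->.
have [q0|q0] := leP 0 q.
  by rewrite -qn gez0_abs// lexx orbT.
by rewrite -qn ltz0_abs// opprK lexx !orbT.
Qed.

Lemma symmetric_min_ge d n e : (forall q, (absz q <= n)%N -> e <= d q) ->
  e <= symmetric_min d n.
Proof.
elim: n => [|n IH] /= H; first exact: H.
rewrite !le_min IH; last by move=> q qn; apply: H; exact: leqW.
by rewrite !H//= abszN.
Qed.

Lemma symmetric_min_homo d m n : (m <= n)%N ->
  symmetric_min d n <= symmetric_min d m.
Proof.
elim: n => [|n IH]; first by rewrite leqn0 => /eqP ->.
rewrite leq_eqVlt => /predU1P[->//|]; rewrite ltnS => /IH h.
by rewrite /= ge_min h.
Qed.

(* If g is badly approximated at infinitely many scales N, then
   psi(n) = min_(|q| <= n) |q alpha - g| is at least 1/N at such an N, so each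
   of these scales adds at least 1/2 to its sum. *)
Lemma Omega11_uniform alpha :
  Omega11 alpha `<=` \bigcup_N0 uniformly_approximable alpha N0.
Proof.
move=> g [g01 Hg]; apply: contrapT => Ng.
pose d (q : int) := dnint (q%:~R * alpha - g).
pose psi := symmetric_min d.
have psi0 n : 0 <= psi n by apply: symmetric_min_ge => q _; exact: dnint_ge0.
have bad N0 : exists N, [/\ (N0 <= N)%N, (0 < N)%N & N%:R^-1 <= psi N].
  apply: contrapT => H; apply: Ng; exists N0 => //; split => // N N0N N_gt0.
  apply: contrapT => H'; apply: H; exists N; split => //.
  apply: symmetric_min_ge => q qN; rewrite leNgt; apply/negP => qlt.
  by apply: H'; exists q.
have big A : exists n, A%:R / 2 <= \sum_(1 <= k < n) psi k.
  elim: A => [|A [n0 IH]]; first by exists 0%N; rewrite mul0r sumr_ge0.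
  (* Since [N >= 2 * n0.+1], at least half of the indices up to [N] are new, and psi is at least 1/N
     on each. *)
  have [N [hN N0 psiN]] := bad (2 * n0.+1)%N.
  exists N.+1; rewrite (@big_cat_nat _ _ _ n0.+1)//=; last by lia.
  have h1 : A%:R / 2 <= \sum_(1 <= i < n0.+1) psi i.
    apply: le_trans IH _; case: n0 {hN} => [|n0]; first by rewrite !big_geq.
    by rewrite [leRHS]big_nat_recr//= lerDl.
  have h2 : 2^-1 <= \sum_(n0.+1 <= i < N.+1) psi i.
    apply: (@le_trans _ _ (\sum_(n0.+1 <= i < N.+1) N%:R^-1)).
      rewrite sumr_const_nat -[leRHS]mulr_natl ler_pdivlMr ?ltr0n//.
      rewrite ler_pdivrMl// -natrM ler_nat; lia.
    rewrite !big_nat; apply: ler_sum => i /andP[_ iN].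
    by apply: le_trans psiN _; apply: symmetric_min_homo.
  by rewrite -natr1 mulrDl mul1r lerD.
have /Hg[_ [_]] : classD psi.
  split; [by []|split; first by move=> m n _; exact: symmetric_min_homo].
  apply/cvgryPge => A.
  have [n hn] := big (Num.truncn (2 * Num.max A 0)).+1.
  exists n => // m /= nm; apply: (@le_trans _ _ (\sum_(1 <= k < n) psi k)).
    apply: le_trans hn; rewrite ler_pdivlMr// mulrC.
    apply: (@le_trans _ _ (2 * Num.max A 0)).
      by rewrite ler_pM2l// le_max lexx.
    by rewrite ltW// truncnS_gt.
  have [n1|n1] := leqP n 1.
    by rewrite [leLHS]big_geq//; apply: sumr_ge0.
  rewrite [leRHS](@big_cat_nat _ _ _ n)//=; [by rewrite lerDl sumr_ge0|exact: ltnW].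
(* By construction psi at |q| never exceeds [d q], so [g] misses this psi for every [q]. *)
set A := [set q | _] => infA; suff A0 : A = set0 by apply: infA; rewrite A0.
apply/seteqP; split => // q Aq.
have : d q < psi (absz q) := Aq.
by rewrite ltNge /psi symmetric_min_le.
Qed.

(* Reduce n modulo q: the multiples of q shift the point by little. *)
Lemma approximation_mod alpha g q (p n : int) : (0 < q)%N ->
  exists (j : nat) (p' : int), (j < q)%N /\
   `|g - (j%:R * alpha - p'%:~R)| <=
     ((absz n)%:R / q%:R + 1) * `|q%:R * alpha - p%:~R| + dnint (n%:~R * alpha - g).
Proof.
move=> q0; have [p0 p0E] := dnint_attained (n%:~R * alpha - g).
have qN0 : q%:Z != 0 by rewrite eqz_nat -lt0n.
have := divz_eq n q; have := modz_ge0 n qN0; have := ltz_pmod n (_ : 0 < q%:Z).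
rewrite ltz_nat => /(_ q0).
set m := (n %/ q)%Z; case: (n %% q)%Z => // j jq _ nE.
exists j, (p0 - m * p); split => //.
have nER : n%:~R = m%:~R * q%:R + j%:R :> R by rewrite nE intrD intrM.
rewrite -p0E.
have -> : g - (j%:R * alpha - (p0 - m * p)%:~R) =
  m%:~R * (q%:R * alpha - p%:~R) - (n%:~R * alpha - g - p0%:~R).
  by rewrite nER intrB intrM; ring.
apply: le_trans (ler_normB _ _) _; rewrite lerD2r normrM ler_wpM2r//.
have qR : 0 < q%:R :> R by rewrite ltr0n.
have -> : (absz n)%:R = `|n%:~R| :> R by rewrite -intr_norm -abszE.
have -> : m%:~R = (n%:~R - j%:R) / q%:R :> R by rewrite nER addrK mulfK ?gt_eqF.
have -> : `|n%:~R| / q%:R + 1 = (`|n%:~R| + q%:R) / q%:R :> R.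
  by rewrite mulrDl divff ?gt_eqF.
rewrite normrM normfV (gtr0_norm qR) ler_pM2r ?invr_gt0//; apply: le_trans (ler_normB _ _) _.
by rewrite lerD2l ger0_norm// ler_nat ltnW.
Qed.

(** The scale is taken just above X = exp((ln q + b)/2), which balances N/(q exp b) against 1/N. Of
    the 4/X, the shift by multiples of [q] costs 2/X (as N <= 2X), the rounding of the quotient 1/X,
    and the approximation of [g] 1/X. *)
Lemma uniformly_approximable_close alpha N0 g q (p : int) (b : R) :
  uniformly_approximable alpha N0 g -> (0 < q)%N ->
  `|q%:R * alpha - p%:~R| <= expR (- b) -> ln q%:R <= b ->
  N0%:R <= expR ((ln q%:R + b) / 2) ->
  exists (j : nat) (p' : int), (j < q)%N /\
   `|g - (j%:R * alpha - p'%:~R)| <= 4 * expR (- ((ln q%:R + b) / 2)).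
Proof.
move=> [_ Hg] q0 qb ab N0X; set a := ln q%:R in ab N0X *.
set X := expR ((a + b) / 2) in N0X *.
have qE : q%:R = expR a :> R by rewrite lnK// posrE ltr0n.
have a0 : 0 <= a by rewrite ln_ge0// ler1n.
have X1 : 1 <= X by rewrite -expR0 ler_expR; lra.
have XN : X < (Num.truncn X).+1%:R by exact: truncnS_gt.
have N2X : (Num.truncn X).+1%:R <= 2 * X.
  have : (Num.truncn X)%:R <= X by rewrite truncn_le; lra.
  rewrite -natr1; lra.
have [||n nN dn] := Hg (Num.truncn X).+1 => //.
  by rewrite -(@ler_nat R); apply: le_trans N0X (ltW XN).
have [j [p' [jq H]]] := approximation_mod alpha g p n q0.
exists j, p'; split => //; apply: le_trans H _.
rewrite expRN -/X.
have dX : dnint (n%:~R * alpha - g) <= X^-1.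
  by apply: le_trans (ltW dn) _; rewrite lef_pV2 ?posrE ?ltr0n ?expR_gt0// ltW.
have bX : `|q%:R * alpha - p%:~R| <= X^-1.
  by apply: le_trans qb _; rewrite /X -expRN ler_expR; lra.
have nX : (absz n)%:R / q%:R * `|q%:R * alpha - p%:~R| <= 2 * X^-1.
  apply: (@le_trans _ _ (2 * X / expR a * expR (- b))).
    rewrite -qE; apply: ler_pM => //.
    rewrite ler_pM2r ?invr_gt0 ?ltr0n//.
    by apply: le_trans N2X; rewrite ler_nat.
  rewrite /X -!expRN -!mulrA ler_pM2l// -!expRD ler_expR; lra.
by rewrite mulrDl mul1r; lra.
Qed.

(** A centre at distance less than 1 from a point of [0,1) lies in (-1,2), where each [j * alpha]
    has at most three integer translates. *)
Lemma fractional_multiples alpha q : exists2 l : seq R, size l = (3 * q)%N &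
  forall (j : nat) (p : int), (j < q)%N -> -1 < j%:R * alpha - p%:~R < 2 ->
    j%:R * alpha - p%:~R \in l.
Proof.
exists [seq j%:R * alpha - (Num.floor (j%:R * alpha))%:~R + (i%:R - 1)
        | j <- iota 0 q, i <- iota 0 3].
  by rewrite size_allpairs !size_iota mulnC.
move=> j p jq /andP[lo hi]; set f := Num.floor (j%:R * alpha).
have := floor_le (j%:R * alpha); have := floorD1_gt (j%:R * alpha).
rewrite -/f intrD1 => hf1 hf2.
have h1 : f - p + 1 < 3.
  by rewrite -(ltr_int R) intrD1 intrB; lra.
have h2 : -1 < f - p + 1.
  by rewrite -(ltr_int R) intrD1 intrB [X in X < _](_ : _ = -1)//; lra.
apply/allpairsP; exists (j, absz (f - p + 1)) => /=; split.
- by rewrite mem_iota.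
- by rewrite !inE; lia.
- have -> : (absz (f - p + 1))%:R = (f - p + 1)%:~R :> R.
    by rewrite -[in RHS](@gez0_abs (f - p + 1))//; lia.
  by rewrite intrD1 intrB -/f; ring.
Qed.

Lemma uniformly_approximable_null alpha N0 s t : 1 <= s -> 0 < t ->
  2 < t * (1 + s) ->
  infinite_set [set q : nat | (0 < q)%N /\ dnint (q%:R * alpha) < q%:R `^ (- s)] ->
  hnull t (uniformly_approximable alpha N0).
Proof.
move=> s1 t0 ts infq; apply: hnull_fin => [|e e0]; first by rewrite gt_eqF.
(* With a = ln q, the 3q balls of radius 4 exp(-(1+s)a/2) have total weight 3 4^t exp(-c a). *)
pose c := t * (1 + s) / 2 - 1; have c0 : 0 < c by rewrite /c; lra.
have [A HA] := expR_eventually_small (3 * 4 `^ t) c0 e0.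
(* The bound [N0] makes the scale admissible, and 4 makes the radius less than 1, as
   [fractional_multiples] requires. *)
pose B := Num.max A (Num.max N0%:R 4).
have [q [q0 dq] hq] := infinite_nat_ge infq (Num.truncn (expR B)).+1.
pose a : R := ln q%:R.
have qE : q%:R = expR a :> R by rewrite lnK// posrE ltr0n.
have Ba : B <= a.
  rewrite -ler_expR -qE ltW//; apply: lt_le_trans (truncnS_gt _) _.
  by rewrite ler_nat.
have [Aa Na a4] : [/\ A <= a, N0%:R <= a & 4 <= a].
  by split; apply: le_trans Ba; rewrite !le_max lexx ?orbT.
have sa : a <= s * a by rewrite ler_peMl//; lra.
have [l sl Hl] := fractional_multiples alpha q.
have X5 : 4 < expR ((a + s * a) / 2).
  apply: lt_le_trans (expR_ge1Dx _); lra.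
exists l, (4 * expR (- ((a + s * a) / 2))); split.
- by rewrite mulr_ge0// expR_ge0.
- move=> g Eg; have [p pE] := dnint_attained (q%:R * alpha).
  have qb : `|q%:R * alpha - p%:~R| <= expR (- (s * a)).
    have -> : expR (- (s * a)) = q%:R `^ (- s) by rewrite qE -expRM mulrN mulrC.
    by rewrite pE ltW.
  have N0X : N0%:R <= expR ((ln q%:R + s * a) / 2).
    by apply: le_trans (expR_ge1Dx _); rewrite -/a; lra.
  have [j [p' [jq H]]] := uniformly_approximable_close Eg q0 qb sa N0X.
  exists (j%:R * alpha - p'%:~R) => //; apply: Hl => //.
  have : 4 * expR (- ((a + s * a) / 2)) < 1.
    by rewrite expRN ltr_pdivrMr ?mul1r// expR_gt0.
  move/(le_lt_trans H); rewrite ltr_norml => /andP[? ?].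
  by case: Eg => /andP[? ?] _; apply/andP; split; lra.
- rewrite sl powRM ?expR_ge0// natrM qE -expRM.
  apply: le_trans (HA _ Aa); rewrite -!mulrA ler_pM2l//.
  rewrite mulrCA ler_pM2l ?powR_gt0// -expRD ler_expR /c; lra.
Qed.

End UniformApproximation.

(** * Lacunary denominators: upper bound *)

Section Lacunary.
Variable R : realType.

(* Inequalities between powers of the Q k become linear in these logarithms. *)
Definition log_conv (Q : nat -> nat) k : R := ln (Q k)%:R.

Variables (alpha eta : R) (Q P : nat -> nat).
Hypothesis cv : convergents alpha Q P.
Local Notation l := (log_conv Q).
Hypothesis eta0 : 0 < eta.
Variable K0 : nat.
Hypothesis growth : forall k, (K0 <= k)%N -> (1 + eta) * l k <= l k.+1.

Lemma ln_convK k : (Q k)%:R = expR (l k) :> R.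
Proof. by rewrite /log_conv lnK// posrE ltr0n (conv_gt0 cv). Qed.

Lemma ln_conv_ge0 k : 0 <= l k.
Proof. by rewrite /log_conv ln_ge0// ler1n (conv_gt0 cv). Qed.

Lemma conv_homo m n : (m <= n)%N -> (Q m <= Q n)%N.
Proof. by move=> mn; apply: (homo_leq (@leqnn) leq_trans (conv_le cv)). Qed.

Lemma ln_conv_large A : exists K, forall k, (K <= k)%N ->
  [/\ (K0 <= k)%N, A <= l k & A <= l k.+1 - l k].
Proof.
pose B := Num.max A (A / eta).
exists (maxn K0 (Num.truncn (expR B)).+1) => k; rewrite geq_max => /andP[Kk hk].
have : B <= l k.
  rewrite -ler_expR -ln_convK ltW//; apply: lt_le_trans (truncnS_gt _) _.
  by rewrite ler_nat; apply: leq_trans hk (conv_ge cv k).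
rewrite ge_max ler_pdivrMr// => /andP[h1 h2]; split=> //.
by have := growth Kk; rewrite mulrDl mul1r; lra.
Qed.

Lemma conv_double : exists K, forall k, (K <= k)%N -> (2 * Q k <= Q k.+1)%N.
Proof.
have [K HK] := ln_conv_large (ln 2); exists K => k /HK[_ _ h].
rewrite -(@ler_nat R) natrM !ln_convK -ler_pdivlMr ?expR_gt0// -expRN -expRD.
by rewrite -[leLHS]lnK ?posrE// ler_expR.
Qed.

(** A good approximation by any [q] is passed on to a convergent: for Q k <= q < Q k.+1, separation
    gives 1/(2 Q k.+1) <= ||q alpha|| < q^(-s) <= (Q k)^(-s). The [ln 2] is the 2 of the separation
    bound. *)
Lemma convergents_infinite s :
  0 < s ->
  infinite_set [set q : nat | (0 < q)%N /\ dnint (q%:R * alpha) < q%:R `^ (- s)] ->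
  forall k0, exists2 k, (k0 <= k)%N & s * l k - ln 2 <= l k.+1.
Proof.
move=> s0 infq k0; have [K HK] := conv_double.
have [q [q0 dq] hq] := infinite_nat_ge infq (Q (maxn K k0)).
have ex : exists k, (q < Q k)%N by exists q.+1; exact: conv_ge cv q.+1.
have [k qk kmin] := ex_minnP ex.
have kK : (maxn K k0 < k)%N.
  by rewrite ltnNge; apply/negP => /conv_homo h; move: qk; rewrite ltnNge (leq_trans h hq).
case: k kK qk kmin => // k; rewrite ltnS geq_max => /andP[Kk k0k] qk kmin.
exists k => //; have Qq : (Q k <= q)%N.
  by rewrite leqNgt; apply/negP => /kmin; rewrite ltnn.
have [p pE] := dnint_attained (q%:R * alpha).
have := @convergents_sep _ _ _ _ k cv (HK k.+1 (leqW Kk)) q%:Z p.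
rewrite eqz_nat -lt0n => /(_ q0 qk); rewrite pE => /le_lt_trans/(_ dq).
have qR : 0 < q%:R :> R by rewrite ltr0n.
have h : s * l k <= s * ln q%:R.
  by rewrite ler_pM2l// /log_conv ler_ln ?posrE ?ltr0n ?(conv_gt0 cv)// ler_nat.
rewrite powRN ltf_pV2 ?posrE ?powR_gt0// ?mulr_gt0// ?ltr0n ?(conv_gt0 cv)//.
move=> /ltW; rewrite -ler_ln ?posrE ?powR_gt0// ?mulr_gt0// ?ltr0n ?(conv_gt0 cv)//.
by rewrite ln_powR lnM ?posrE ?ltr0n ?(conv_gt0 cv)// -/(log_conv Q k.+1); lra.
Qed.

(** The radius given by [uniformly_approximable_close] for [q = Q k] and [b = l k.+1]. *)
Definition cover_radius k : R := 4 * expR (- ((l k + l k.+1) / 2)).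

Local Notation r := cover_radius.

Definition lattice k := [set y : R | exists (j : nat) (p : int),
  (j < Q k)%N /\ y = j%:R * alpha - p%:~R].

(** Differences of lattice points have coefficient below [Q k.+1] in absolute value, so
    [convergents_sep] applies unless it vanishes; then an integer of size less than 1 is left. *)
Lemma lattice_sep k y y' : (2 * Q k.+1 <= Q k.+2)%N ->
  lattice k.+1 y -> lattice k.+1 y' -> `|y - y'| < (2 * (Q k.+1)%:R)^-1 -> y = y'.
Proof.
move=> Qk [j [p [jQ ->]]] [j' [p' [j'Q ->]]].
have -> : j%:R * alpha - p%:~R - (j'%:R * alpha - p'%:~R) =
    (j%:Z - j'%:Z)%:~R * alpha - (p - p')%:~R by rewrite !intrB; ring.
have [/eqP|jj] := eqVneq (j%:Z - j'%:Z) 0.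
  rewrite subr_eq0 eqz_nat => /eqP -> ; rewrite subrr mul0r sub0r normrN -intr_norm => h.
  have pp : `|p - p'| < 1.
    rewrite -(ltr_int R); apply: lt_le_trans h _.
    rewrite invf_le1 ?mulr_gt0 ?ltr0n ?(conv_gt0 cv)// -natrM ler1n.
    by rewrite muln_gt0 (conv_gt0 cv).
  by have -> : p = p' by lia.
by rewrite ltNge (convergents_sep cv Qk)//; lia.
Qed.

(* A cell of the grid of mesh 1 / (2 Q k.+1) contains at most one lattice point. *)
Lemma cover_ball N0 k x : (2 * Q k.+1 <= Q k.+2)%N -> r k.+1 <= r k ->
  N0%:R <= expR ((l k.+1 + l k.+2) / 2) ->
  exists c : seq R, (size c)%:R <= 33 * expR ((l k.+1 - l k) / 2) /\
   forall g, uniformly_approximable alpha N0 g -> `|g - x| <= r k ->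
     exists2 y, y \in c & `|g - y| <= r k.+1.
Proof.
move=> Qk rk N0k; have Q0 : 0 < (Q k.+1)%:R :> R by rewrite ltr0n (conv_gt0 cv).
pose gap : R := (2 * (Q k.+1)%:R)^-1.
have gap0 : 0 < gap by rewrite invr_gt0 mulr_gt0.
(* Left end of a window of length [4 * r k] around [x]: a relevant centre is within [r k.+1 <= r k]
   of [g], which is within [r k] of [x]. *)
pose a := x - 2 * r k.
pose f i := xget 0 [set y | lattice k.+1 y /\ a + i%:R * gap <= y < a + i.+1%:R * gap].
pose n := Num.truncn (4 * r k / gap).
have n0 : 0 <= 4 * r k / gap.
  by rewrite divr_ge0// ?(ltW gap0)// !mulr_ge0// expR_ge0.
exists [seq f i | i <- iota 0 n.+1]; split.
  rewrite size_map size_iota -natr1.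
  have h : n%:R <= 4 * r k / gap by rewrite truncn_le.
  (* The constant 33 is this 32 plus 1 for the extra cell in [n.+1]. *)
  have e : 4 * r k / gap = 32 * expR ((l k.+1 - l k) / 2).
    rewrite /gap invrK /cover_radius ln_convK.
    have -> : (l k.+1 - l k) / 2 = - ((l k + l k.+1) / 2) + l k.+1 by lra.
    by rewrite expRD; ring.
  have : 1 <= expR ((l k.+1 - l k) / 2).
    rewrite -expR0 ler_expR divr_ge0// subr_ge0 /log_conv ler_ln ?posrE ?ltr0n ?(conv_gt0 cv)//.
    by rewrite ler_nat (conv_le cv).
  lra.
move=> g Eg gx.
have [||//|j [p [jQ gy]]] := @uniformly_approximable_close _ alpha N0 g (Q k.+1) (P k.+1) (l k.+2) Eg (conv_gt0 cv _).
- by rewrite expRN -ln_convK ltW// (conv_ub cv).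
- by rewrite /log_conv ler_ln ?posrE ?ltr0n ?(conv_gt0 cv)// ler_nat (conv_le cv).
pose y := j%:R * alpha - p%:~R; exists y => //.
pose i := Num.truncn ((y - a) / gap).
have ya : `|y - x| <= 2 * r k.
  have := ler_normB (g - x) (g - y).
  have -> : g - x - (g - y) = y - x by ring.
  have : `|g - y| <= r k.+1 := gy; lra.
have /andP[y1 y2] : 0 <= y - a <= 4 * r k.
  by move: ya; rewrite ler_norml /a => /andP[? ?]; apply/andP; split; lra.
have /truncn_itv : 0 <= (y - a) / gap by rewrite divr_ge0// ltW.
rewrite -/i ler_pdivlMr// ltr_pdivrMr// => /andP[i1 i2].
apply/mapP; exists i.
  rewrite mem_iota /= add0n ltnS; apply: le_truncn.
  by rewrite ler_pM2r// invr_gt0.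
have yl : lattice k.+1 y by exists j, p.
have [fl /andP[f1 f2]] : [set y | lattice k.+1 y /\ a + i%:R * gap <= y < a + i.+1%:R * gap] (f i).
  apply: (@xgetPex _ 0 [set y | lattice k.+1 y /\ a + i%:R * gap <= y < a + i.+1%:R * gap]).
  by exists y; split => //; apply/andP; split; lra.
apply: (lattice_sep Qk) => //; rewrite -/gap.
rewrite -natr1 mulrDl mul1r in f2 i2.
by rewrite ltr_norml; apply/andP; split; lra.
Qed.

Lemma cover_step N0 k (c : seq R) : (2 * Q k.+1 <= Q k.+2)%N -> r k.+1 <= r k ->
  N0%:R <= expR ((l k.+1 + l k.+2) / 2) ->
  exists c' : seq R,
   (size c')%:R <= (size c)%:R * (33 * expR ((l k.+1 - l k) / 2)) /\
   forall g, uniformly_approximable alpha N0 g ->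
     (exists2 x, x \in c & `|g - x| <= r k) ->
     exists2 y, y \in c' & `|g - y| <= r k.+1.
Proof.
move=> Qk rk N0k; elim: c => [|x c [c' [s' H']]].
  by exists [::]; rewrite mul0r; split => // g _ [].
have [cx [sx Hx]] := cover_ball x Qk rk N0k.
exists (cx ++ c'); split.
  by rewrite size_cat natrD /= -[in leRHS]natr1 mulrDl mul1r addrC lerD.
move=> g Eg [z]; rewrite inE => /predU1P[->|zc] gz.
  by have [y yc gy] := Hx g Eg gz; exists y => //; rewrite mem_cat yc.
have [|y yc gy] := H' g Eg; first by exists z.
by exists y => //; rewrite mem_cat yc orbT.
Qed.

(* A cover of scale k has about exp((1/2 + d) l_k) balls of radius about
   exp(-(l_k + l_(k+1))/2): the constant lost at each step is absorbed by d,
   because l_(k+1) - l_k is large. *)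
Lemma uniformly_approximable_null_lacunary N0 s t : 0 < t -> 1 < t * (1 + s) ->
  (forall k0, exists2 k, (k0 <= k)%N & s * l k - ln 2 <= l k.+1) ->
  hnull t (uniformly_approximable alpha N0).
Proof.
(* [d] is a quarter of the slack: since t(1+s)/2 = 1/2 + 2d, the count exp((1/2 + d) l_k) leaves a
   factor exp(-d l_k) in the final weight. *)
move=> t0 ts infk; pose d := (t * (1 + s) - 1) / 4.
have d0 : 0 < d by rewrite /d; lra.
pose A : R := Num.max N0%:R (ln 33 / d).
have [K1 HK1] := ln_conv_large A; have [K2 HK2] := conv_double.
pose K := maxn K1 K2.
have HK k : (K <= k)%N -> [/\ (2 * Q k.+1 <= Q k.+2)%N, r k.+1 <= r k,
   N0%:R <= expR ((l k.+1 + l k.+2) / 2) & 33 <= expR (d * (l k.+1 - l k))].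
  rewrite geq_max => /andP[k1 k2]; have [_ h1 h2] := HK1 _ k1.
  have [_ h3 h4] := HK1 _ (leqW k1).
  have A0 : 0 <= A by rewrite le_max ler0n.
  split.
  - exact/HK2/leqW.
  - rewrite /cover_radius ler_pM2l// ler_expR; lra.
  - apply: le_trans (expR_ge1Dx _); have : N0%:R <= A by rewrite le_max lexx.
    lra.
  - rewrite -[leLHS]lnK ?posrE// ler_expR mulrC -ler_pdivrMr//.
    by apply: le_trans h2; rewrite le_max lexx orbT.
have rK0 : 0 < r K by rewrite mulr_gt0// expR_gt0.
have [C C0 cover] : exists2 C : R, 0 <= C & forall m, exists c : seq R,
    (size c)%:R <= C * expR ((2^-1 + d) * l (K + m)) /\
    forall g, uniformly_approximable alpha N0 g ->
      exists2 x, x \in c & `|g - x| <= r (K + m).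
  (* The first cover is a plain grid of [0,1) of mesh [r K], whose size is the constant [C]. *)
  pose n := (Num.truncn (r K)^-1).+1.
  exists n%:R => //; elim=> [|m [c [sc Hc]]].
    rewrite addn0; exists [seq i%:R * r K | i <- iota 0 n]; split.
      rewrite size_map size_iota ler_peMr// -expR0 ler_expR.
      by rewrite mulr_ge0 ?ln_conv_ge0// addr_ge0// ltW.
    move=> g [/andP[g0 g1] _]; have /truncn_itv : 0 <= g / r K by rewrite divr_ge0// ltW.
    set i := Num.truncn _; rewrite ler_pdivlMr// ltr_pdivrMr// => /andP[i1 i2].
    exists (i%:R * r K).
      apply/mapP; exists i => //; rewrite mem_iota /= add0n ltnS.
      by apply: le_truncn; rewrite ler_piMl ?invr_ge0// ltW.
    rewrite -natr1 mulrDl mul1r in i2.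
    by rewrite ler_norml; apply/andP; split; lra.
  have [h1 h2 h3 h4] := HK _ (leq_addr m K).
  have [c' [sc' Hc']] := cover_step c h1 h2 h3.
  rewrite addnS; exists c'; split; last by move=> g Eg; apply: (Hc' g Eg); exact: Hc.
  apply: le_trans sc' _.
  apply: (@le_trans _ _ (n%:R * expR ((2^-1 + d) * l (K + m)) *
    (expR (d * (l (K + m).+1 - l (K + m))) * expR ((l (K + m).+1 - l (K + m)) / 2)))).
    by apply: ler_pM => //; rewrite ?mulr_ge0 ?expR_ge0 ?ler_pM2r ?expR_gt0.
  by rewrite -mulrA ler_wpM2l// -!expRD ler_expR; lra.
apply: hnull_fin => [|e e0]; first by rewrite gt_eqF.
have [B HB] := expR_eventually_small (C * 4 `^ t * expR (t * ln 2 / 2)) d0 e0.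
have [K3 HK3] := ln_conv_large B.
(* The weight is evaluated only at a scale where [l k.+1] is nearly [s * l k] or larger; only there
   are the balls known to be small enough. *)
have [k] := infk (maxn K K3); rewrite geq_max => /andP[Kk /HK3[_ Bk _]] sk.
have [c [sc Hc]] := cover (k - K)%N; rewrite subnKC// in sc Hc.
exists c, (r k); split => //; first by rewrite mulr_ge0// expR_ge0.
apply: le_trans (HB _ Bk).
apply: (@le_trans _ _ (C * expR ((2^-1 + d) * l k) *
   (4 `^ t * expR (t * ln 2 / 2 - t * (1 + s) / 2 * l k)))).
  apply: ler_pM => //; first exact: powR_ge0.
  rewrite /cover_radius powRM ?expR_ge0// ler_pM2l ?powR_gt0// -expRM ler_expR.
  by have : t * (s * l k - ln 2) <= t * l k.+1 := ler_wpM2l (ltW t0) sk; lra.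
have -> : C * expR ((2^-1 + d) * l k) *
   (4 `^ t * expR (t * ln 2 / 2 - t * (1 + s) / 2 * l k)) =
   C * 4 `^ t * (expR ((2^-1 + d) * l k) * expR (t * ln 2 / 2 - t * (1 + s) / 2 * l k)) by ring.
rewrite -!mulrA ler_wpM2l// ler_pM2l ?powR_gt0// -!expRD ler_expR /d; lra.
Qed.

End Lacunary.

(** * Selecting a branch of a tree of intervals *)

Section DigitTree.
Variable R : realType.
Variables (D r : nat -> R) (nc : nat -> nat).
Hypothesis nc_gt0 : forall k, (0 < nc k)%N.
Hypothesis r_ge0 : forall k, 0 <= r k.
Hypothesis nested : forall k m, (m < nc k)%N ->
  `|m.+1%:R * D k| + r k.+1 <= r k.
Implicit Types (U : set R) (x : R).

(** The digit is [m.+1], never 0, so that the indices j_k attached to the nodes strictly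
    increase. *)
Definition child k x m := x + m.+1%:R * D k.

Definition touches U k x : bool := `[< exists2 y, U y & `|y - x| <= r k >].

Lemma touches_child U k x m : (m < nc k)%N ->
  touches U k.+1 (child k x m) -> touches U k x.
Proof.
move=> mk /asboolP[y Uy yx]; apply/asboolP; exists y => //.
have -> : y - x = (y - child k x m) + m.+1%:R * D k by rewrite /child; ring.
by apply: le_trans (ler_normD _ _) _; have := nested mk; lra.
Qed.

(* The proportion of the descendants of (k, x) at depth n that touch U. *)
Fixpoint mass U n k x : R :=
  if n is n'.+1 then (\sum_(m < nc k) mass U n' k.+1 (child k x m)) / (nc k)%:R
  else (touches U k x)%:R.

Lemma mass_ge0 U n k x : 0 <= mass U n k x.
Proof.
elim: n k x => [|n IH] k x /=; first exact: ler0n.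
by rewrite divr_ge0// sumr_ge0.
Qed.

Lemma mass_avg_le U n k x B : (forall m, (m < nc k)%N -> mass U n k.+1 (child k x m) <= B) ->
  mass U n.+1 k x <= B.
Proof.
move=> H /=; rewrite ler_pdivrMr ?ltr0n//.
apply: (@le_trans _ _ (\sum_(m < nc k) B)); first by apply: ler_sum => m _; exact: H.
by rewrite sumr_const card_ord -[leLHS]mulr_natr.
Qed.

Lemma mass_le1 U n k x : mass U n k x <= 1.
Proof.
elim: n k x => [|n IH] k x; first by rewrite /= lern1 leq_b1.
exact: mass_avg_le.
Qed.

Lemma mass_untouched U n k x : ~~ touches U k x -> mass U n k x = 0.
Proof.
elim: n k x => [|n IH] k x /= H; first by rewrite (negbTE H).
rewrite big1 ?mul0r// => m _; apply: IH; apply: contra H.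
exact: touches_child.
Qed.

(** Above depth [N] this is the defining average. From [N] on the truncated subtraction freezes the
    mass at depth 0, and a touched child has a touched parent. *)
Lemma mass_super U N k x :
  \sum_(m < nc k) mass U (N - k.+1) k.+1 (child k x m) <= (nc k)%:R * mass U (N - k) k x.
Proof.
have [Nk|kN] := leqP N k.
  have -> : (N - k = 0)%N by apply/eqP; rewrite subn_eq0.
  have -> : (N - k.+1 = 0)%N by apply/eqP; rewrite subn_eq0 leqW.
  apply: (@le_trans _ _ (\sum_(m < nc k) mass U 0 k x)).
    apply: ler_sum => m _ /=; rewrite ler_nat; have := @touches_child U k x m (ltn_ord m).
    by case: (touches U k.+1 _) => // ->.
  by rewrite sumr_const card_ord -[leLHS]mulr_natl.
have -> : (N - k = (N - k.+1).+1)%N by lia.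
by rewrite /= mulrC divfK// pnatr_eq0 -lt0n.
Qed.

Lemma mass_one_child U n k x B : 0 <= B ->
  (forall m m', (m < nc k)%N -> (m' < nc k)%N ->
     touches U k.+1 (child k x m) -> touches U k.+1 (child k x m') -> m = m') ->
  (forall y, mass U n k.+1 y <= B) -> mass U n.+1 k x <= B / (nc k)%:R.
Proof.
move=> B0 one H; rewrite /= ler_pM2r ?invr_gt0 ?ltr0n//.
have [[m0 t0]|no] := pselect (exists m : 'I_(nc k), touches U k.+1 (child k x m)); last first.
  rewrite big1// => m _; apply: mass_untouched; apply/negP => t0.
  by apply: no; exists m.
rewrite (bigD1 m0)//= big1 ?addr0// => m mm0; apply: mass_untouched.
apply: contra mm0 => t1; apply/eqP/val_inj.
exact: one (ltn_ord m) (ltn_ord m0) t1 t0.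
Qed.

(** Each level at which at most one child is touched divides the mass by the number of children. *)
Lemma mass_narrow U n n' k x B : 0 <= B ->
  (forall i y m m', (i < n)%N -> (m < nc (k + i))%N -> (m' < nc (k + i))%N ->
     touches U (k + i).+1 (child (k + i) y m) ->
     touches U (k + i).+1 (child (k + i) y m') -> m = m') ->
  (forall y, mass U n' (k + n) y <= B) ->
  mass U (n + n') k x <= B / \prod_(i < n) (nc (k + i))%:R.
Proof.
elim: n k x => [|n IH] k x B0 one HB.
  by rewrite big_ord0 divr1; have := HB x; rewrite addn0.
have -> : \prod_(i < n.+1) (nc (k + i))%:R =
    (nc k)%:R * \prod_(i < n) (nc (k.+1 + i))%:R :> R.
  rewrite big_ord_recl /= addn0; congr (_ * _).
  by apply: eq_bigr => i _; rewrite /bump /= add1n addnS.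
rewrite invfM mulrCA mulrC addSn; apply: mass_one_child.
- by rewrite divr_ge0// prodr_ge0.
- by move=> m m'; have := @one 0%N x m m' isT; rewrite addn0.
- move=> y; apply: IH => //; last by move=> z; rewrite addSnnS.
  by move=> i z m m' ii; rewrite addSnnS; exact: one.
Qed.

(** All touched digits lie in the window of [V.+1] digits that starts at the least touched one. *)
Lemma mass1_count U k x V :
  (forall m m', (m < nc k)%N -> (m' < nc k)%N -> (m <= m')%N ->
     touches U k.+1 (child k x m) -> touches U k.+1 (child k x m') -> (m' <= m + V)%N) ->
  mass U 1 k x <= V.+1%:R / (nc k)%:R.
Proof.
move=> H /=; rewrite ler_pM2r ?invr_gt0 ?ltr0n//.
pose b m := touches U k.+1 (child k x m).
have -> : \sum_(m < nc k) (touches U k.+1 (child k x m))%:R =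
    (\sum_(0 <= m < nc k) b m)%:R :> R by rewrite big_mkord natr_sum.
rewrite ler_nat.
have -> : (\sum_(0 <= m < nc k) b m = size [seq m <- iota 0 (nc k) | b m])%N.
  rewrite size_filter -sum1_count [RHS]big_mkcond /index_iota subn0.
  by apply: eq_bigr => i _; case: (b i).
have [[m0 /andP[m0n bm0] m0min]|no] := pselect (exists2 m0, (m0 < nc k)%N && b m0 &
   forall m, (m < nc k)%N && b m -> (m0 <= m)%N); last first.
  rewrite (_ : [seq _ <- _ | _] = [::])//; apply/eqP; rewrite -[_ == _]negbK -has_filter.
  apply/negP => /hasP[m]; rewrite mem_iota => /andP[_ mn] bm; apply: no.
  have ex : exists m, (m < nc k)%N && b m by exists m; apply/andP.
  by exists (ex_minn ex); case: ex_minnP.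
rewrite -(size_iota m0 V.+1); apply: uniq_leq_size.
  by rewrite filter_uniq// iota_uniq.
move=> m; rewrite mem_filter !mem_iota => /and3P[bm _ mn].
have m0m : (m0 <= m)%N by apply: m0min; rewrite mn bm.
by rewrite m0m /= addnS ltnS; exact: H.
Qed.

(* The total mass of a family U is a supermartingale along the tree: starting
   below 1 one can always move to a child where it stays below 1. *)
Lemma avoid (U : nat -> set R) (N : nat -> nat) x0 :
  (\sum_(0 <= i <oo) (mass (U i) (N i) 0 x0)%:E < 1)%E ->
  exists (m : nat -> nat) g, [/\ forall k, (m k < nc k)%N,
    forall k, `|g - (x0 + \sum_(i < k) (m i).+1%:R * D i)| <= r k
  & forall i, ~ U i g].
Proof.
pose S k x := (\sum_(0 <= i <oo) (mass (U i) (N i - k) k x)%:E)%E.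
move=> S0.
pose good k x := [set m | (m < nc k)%N /\ (S k.+1 (child k x m) < 1)%E].
have step k x : (S k x < 1)%E -> good k x !=set0.
  move=> Sx; apply: contrapT => H.
  have {}H (m : 'I_(nc k)) : (1 <= S k.+1 (child k x m))%E.
    rewrite leNgt; apply/negP => h; apply: H; exists m; split => //.
  have : ((nc k)%:R%:E <= (nc k)%:R%:E * S k x)%E.
    apply: (@le_trans _ _ (\sum_(m < nc k) S k.+1 (child k x m))%E).
      apply: (@le_trans _ _ (\sum_(m < nc k) 1)%E); last by apply: lee_sum => m _; exact: H.
      by rewrite sumEFin sumr_const card_ord.
    rewrite /S -nneseriesZl; last by move=> i _; rewrite lee_fin mass_ge0.
    rewrite -nneseries_sum; last by move=> i j _; rewrite lee_fin mass_ge0.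
    apply: lee_nneseries => [i _ _|i _].
      by apply: sume_ge0 => m _; rewrite lee_fin mass_ge0.
    by rewrite sumEFin -EFinM lee_fin mass_super.
  have Sx0 : (0 <= S k x)%E by apply: nneseries_ge0 => i _ _; rewrite lee_fin mass_ge0.
  case: (S k x) Sx Sx0 => // s; rewrite !lte_fin lee_fin => s1 s0.
  by rewrite -EFinM lee_fin ler_pMr ?ltr0n// leNgt s1.
pose fix X k := if k is k'.+1 then child k' (X k') (xget 0%N (good k' (X k'))) else x0.
pose m k := xget 0%N (good k (X k)).
have SX k : (S k (X k) < 1)%E.
  elim: k => [|k IH]; first by rewrite /S; under eq_eseriesr do rewrite subn0.
  by have /(xgetPex 0%N)[] := step _ _ IH.
have mk k : (m k < nc k)%N by have /(xgetPex 0%N)[] := step _ _ (SX k).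
have XE k : X k = x0 + \sum_(i < k) (m i).+1%:R * D i.
  elim: k => [|k IH]; first by rewrite big_ord0 addr0.
  by rewrite big_ord_recr /= addrA -IH.
have nest k n : `|X (k + n)%N - X k| <= r k - r (k + n)%N.
  elim: n => [|n IH]; first by rewrite addn0 !subrr normr0.
  rewrite addnS /= -/(m _) /child; set y := _ * _.
  have := nested (mk (k + n)%N); rewrite -/y => h.
  have := ler_normD (X (k + n)%N - X k) y; rewrite addrAC; lra.
(* The intervals of radius [r k] around [X k] are nested; the supremum of their left ends lies in
   all of them. *)
pose A := range (fun k => X k - r k).
have ubA j : ubound A (X j + r j).
  move=> _ [k _ <-].
  have [kj|jk] := leqP k j.
    have := nest k (j - k)%N; rewrite subnKC// ler_norml => /andP[? ?].
    have := r_ge0 j; lra.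
  have := nest j (k - j)%N; rewrite (subnKC (ltnW jk)) ler_norml => /andP[? ?].
  have := r_ge0 k; lra.
have A0 : A !=set0 by exists (X 0%N - r 0%N), 0%N.
have gX k : `|sup A - X k| <= r k.
  have : sup A <= X k + r k by apply: sup_le_ub.
  have : X k - r k <= sup A.
    apply: ub_le_sup; last by exists k.
    by exists (X 0%N + r 0%N).
  by rewrite ler_norml => ? ?; apply/andP; split; lra.
exists m, (sup A); split => // [k|i Ui]; first by rewrite -XE.
(* At depth [N i] the mass of [U i] is the indicator of being touched; being below 1 it is 0,
   whereas the limit point would witness a contact. *)
have : ((mass (U i) (N i - N i) (N i) (X (N i)))%:E < 1)%E.
  apply: le_lt_trans (SX (N i)).
  rewrite /S (@nneseriesD1 _ _ i)//; last by move=> n _; rewrite lee_fin mass_ge0.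
  by rewrite leeDl// nneseries_ge0// => n _ _; rewrite lee_fin mass_ge0.
rewrite subnn /=; suff -> : touches (U i) (N i) (X (N i)) by rewrite ltxx.
by apply/asboolP; exists (sup A).
Qed.

End DigitTree.

(** * The Cantor set of digit expansions *)

Section LowerBound.
Variable R : realType.
Variables (alpha eta delta : R) (q p : nat -> nat) (L : nat -> R).
Local Notation theta := (eta * delta).
Local Notation D k := ((q k)%:R * alpha - (p k)%:R : R).
(* q and p are the tails of the sequences of denominators and numerators. *)
Hypothesis qE : forall k, (q k)%:R = expR (L k).
Hypothesis q_ge : forall k, (k <= q k)%N.
Hypothesis D_ub : forall k, `|D k| <= expR (- L k.+1).
Hypothesis D_lb : forall k, expR (- L k.+1) / 2 <= `|D k|.
Hypothesis eta0 : 0 < eta.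
Hypothesis delta0 : 0 < delta.
Hypothesis delta2 : delta < 2^-1.
Hypothesis L0 : forall k, 0 <= L k.
Hypothesis growth : forall k, eta * L k <= L k.+1 - L k.
Hypothesis gap32 : forall k, 32 <= expR ((L k.+1 - L k) / 2).
Hypothesis gap2 : forall k, 2 <= expR (2 * theta * (L k.+1 - L k)).

Definition digit_scale k : R := expR (- (theta * L k) + (L k.+1 - L k) / 2).
Definition digit_count k := (Num.truncn (digit_scale k)).+1.
(** This is 4 y_k / q_(k+1): one half bounds a digit step, the other half holds the next radius. *)
Definition node_radius k : R := 4 * expR (- (theta * L k) - (L k + L k.+1) / 2).
Local Notation y := digit_scale.
Local Notation nc := digit_count.
Local Notation r := node_radius.

Lemma theta_gt0 : 0 < theta.
Proof. exact: mulr_gt0. Qed.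

Lemma L_homo k : L k <= L k.+1.
Proof. by have := growth k; have := mulr_ge0 (ltW eta0) (L0 k); lra. Qed.

(** As [delta < 1/2], the growth condition bounds [theta * L k] by half of [L k.+1 - L k]. *)
Lemma digit_scale_ge1 k : 1 <= y k.
Proof.
rewrite -expR0 ler_expR; have := growth k.
by have := ler_wpM2r (mulr_ge0 (ltW eta0) (L0 k)) (ltW delta2); lra.
Qed.

Lemma digit_count_ub k : (nc k)%:R <= 2 * y k.
Proof.
have y1 := digit_scale_ge1 k.
have : (Num.truncn (y k))%:R <= y k by rewrite truncn_le; lra.
have -> : (nc k)%:R = (Num.truncn (y k))%:R + 1 :> R by rewrite natr1.
lra.
Qed.

Lemma digit_count_lb k : y k <= (nc k)%:R.
Proof. exact/ltW/truncnS_gt. Qed.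

Lemma node_radius_ge0 k : 0 <= r k.
Proof. by rewrite mulr_ge0// expR_ge0. Qed.

Lemma node_radiusE k : r k = 4 * (y k * expR (- L k.+1)).
Proof. by rewrite /r /y -expRD; congr (4 * expR _); lra. Qed.

Lemma node_radius_half k : r k.+1 <= r k / 2.
Proof.
rewrite ler_pdivlMr// mulrC.
have h2 : 2 <= expR ((L k.+1 - L k) / 2) by have := gap32 k; lra.
apply: le_trans (ler_wpM2r (node_radius_ge0 _) h2) _.
rewrite /r mulrCA -expRD ler_pM2l// ler_expR.
have := L_homo k; have := L_homo k.+1; have := theta_gt0 => h0 h1 h3.
have : theta * L k <= theta * L k.+1 by rewrite ler_pM2l.
lra.
Qed.

Lemma digit_step_nested k m : (m < nc k)%N -> `|m.+1%:R * D k| + r k.+1 <= r k.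
Proof.
move=> mk; have : `|m.+1%:R * D k| <= r k / 2; last by have := node_radius_half k; lra.
have -> : r k / 2 = 2 * y k * expR (- L k.+1) by rewrite node_radiusE; lra.
rewrite normrM; apply: ler_pM => //.
by apply: le_trans (digit_count_ub k); rewrite ger0_norm// ler_nat.
Qed.

(** Siblings are at least 1/(2 q_(k+1)) apart, so this keeps their intervals disjoint; 1/8 is 4/32,
    with the 32 of [gap32]. *)
Lemma node_radius_sep k : r k.+1 <= expR (- L k.+1) / 8.
Proof.
rewrite ler_pdivlMr// /r.
have -> : - (theta * L k.+1) - (L k.+1 + L k.+2) / 2 =
  - (theta * L k.+1 + (L k.+2 - L k.+1) / 2) + - L k.+1 by lra.
rewrite expRD expRN expRD; set a := expR _; set b := expR (_ / 2); set c := expR _.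
have a1 : 1 <= a by rewrite -expR0 ler_expR mulr_ge0// ltW// theta_gt0.
have b32 : 32 <= b := gap32 k.+1.
have ab : 32 <= a * b by apply: le_trans b32 _; rewrite ler_peMl// expR_ge0.
have c0 : 0 < c := expR_gt0 _.
have : (a * b)^-1 <= 32^-1.
  by rewrite lef_pV2 ?posrE//; apply: lt_le_trans ab.
by move=> /(ler_wpM2r (ltW c0)); lra.
Qed.

Local Notation touches := (touches r).
Local Notation mass := (mass (fun k => D k) r nc).
Local Notation child := (child (fun k => D k)).

(** Points of [U] in the two child intervals give (m' - m)|D k| <= d + 2 r_(k+1); multiply by 2
    q_(k+1) and use the lower bound on |D k|. The remainder 1/2 is below 1, so a set of small
    diameter touches only one child. *)
Lemma touched_digits (U : set R) (d : R) k x m m' :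
  (forall u v, U u -> U v -> `|u - v| <= d) -> (m <= m')%N ->
  touches U k.+1 (child k x m) -> touches U k.+1 (child k x m') ->
  (m' - m)%:R <= 2 * expR (L k.+1) * d + 2^-1.
Proof.
move=> Ud mm' /asboolP[u Uu ux] /asboolP[v Uv vx].
have := Ud _ _ Uu Uv; have := node_radius_sep k; have := D_lb k.
rewrite expRN; set q' := expR _ => Dlb rs uv.
have q0 : 0 < q' by exact: expR_gt0.
have : (m' - m)%:R * `|D k| <= d + q'^-1 / 4.
  have -> : (m' - m)%:R * `|D k| = `|(u - child k x m) - (v - child k x m') - (u - v)|.
    have -> : (m' - m)%:R = `|(m'%:R - m%:R)| :> R.
      by rewrite -natrB// ger0_norm.
    by rewrite -normrM /child -!natr1; congr (`|_|); ring.
  apply: le_trans (ler_normB _ _) _.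
  by have := ler_normB (u - child k x m) (v - child k x m'); lra.
have : (m' - m)%:R * (q'^-1 / 2) <= (m' - m)%:R * `|D k| by rewrite ler_wpM2l.
move=> h1 h2; have {h1 h2} := le_trans h1 h2.
move=> /(ler_wpM2l (ltW (mulr_gt0 (ltr0n R 2) q0))).
rewrite !mulrDr.
have -> : 2 * q' * ((m' - m)%:R * (q'^-1 / 2)) = (m' - m)%:R by field; rewrite gt_eqF.
have -> : 2 * q' * (q'^-1 / 4) = 2^-1 by field; rewrite gt_eqF.
by [].
Qed.

(** By growth [theta * L k] is at most [delta * (L k.+1 - L k)], so the lower bounds on the digit
    counts telescope. *)
Lemma prod_digit_count n :
  expR ((2^-1 - delta) * (L n - L 0)) <= \prod_(i < n) (nc i)%:R.
Proof.
elim: n => [|n IH]; first by rewrite big_ord0 subrr mulr0 expR0.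
rewrite big_ord_recr /=.
apply: le_trans (ler_pM (expR_ge0 _) (expR_ge0 _) IH (digit_count_lb n)).
rewrite -expRD ler_expR; have := growth n => /(ler_wpM2l (ltW delta0)); lra.
Qed.

(** * Mass of a set of given diameter *)

Variables (w t : R).
Hypothesis L_ub : forall k, L k.+1 <= w * L k.
Hypothesis t0 : 0 < t.
Hypothesis t1 : t <= 1.
Hypothesis tw : t * (1 + w) / 2 + t * theta + delta <= 2^-1.

Definition mass_constant : R :=
  8 `^ t * expR ((2^-1 - delta) * L 0) + (4 * expR (L 0)) `^ t.

(** A mass distribution principle. If 4 d q_0 >= 1, the second part of the constant already exceeds
    the total mass. If d = 0, one branch is followed until its mass is below [e], the only use of
    [e]. Otherwise take 4 d q_n < 1 <= 4 d q_(n+1): one child is touched at each of the first n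
    levels, and at level n about d q_(n+1) out of y_n children. *)
Lemma mass_diam_le (U : set R) (d e x : R) : 0 <= d -> 0 < e ->
  (forall u v, U u -> U v -> `|u - v| <= d) ->
  exists N, mass U N 0 x <= mass_constant * d `^ t + e.
Proof.
move=> d0 e0 Ud.
have ncg k : (0 < nc k)%N by [].
have p1 : 1 = 1 `^ t :> R by rewrite powR1.
have C1 : 0 <= 8 `^ t * expR ((2^-1 - delta) * L 0) :> R.
  by rewrite mulr_ge0// ?powR_ge0 ?expR_ge0.
have C2 : 0 <= (4 * expR (L 0)) `^ t by exact: powR_ge0.
have dt0 : 0 <= d `^ t := powR_ge0 _ _.
have narrow n (B : R) : 0 <= B -> d * (4 * expR (L n)) < 1 ->
    (forall z, mass U 1 n z <= B) ->
    mass U n.+1 0 x <= B / \prod_(i < n) (nc i)%:R.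
  move=> B0 dn HB; rewrite -addn1.
  apply: (@mass_narrow _ _ _ _ ncg digit_step_nested U n 1 0 x B) => //.
  move=> i z m m' ilt mi mi'; rewrite add0n => h h'.
  have Lin : expR (L i.+1) <= expR (L n).
    by rewrite ler_expR; apply: (homo_leq (@lexx _ R) le_trans L_homo).
  have small : 2 * expR (L i.+1) * d + 2^-1 < 1.
    have := ler_wpM2r d0 Lin; lra.
  have [mm'|/ltnW m'm] := leqP m m'.
    have := le_lt_trans (touched_digits Ud mm' h h') small.
    rewrite ltrn1 ltnS leqn0 subn_eq0 => m'm.
    by apply/eqP; rewrite eqn_leq mm' m'm.
  have := le_lt_trans (touched_digits Ud m'm h' h) small.
  rewrite ltrn1 ltnS leqn0 subn_eq0 => mm'.
  by apply/eqP; rewrite eqn_leq mm' m'm.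
have [big|] := leP 1 (d * (4 * expR (L 0))).
  exists 0%N; apply: le_trans (mass_le1 _ _ ncg _ _ _ _) _.
  have : 1 <= (4 * expR (L 0)) `^ t * d `^ t.
    rewrite -powRM ?mulr_ge0 ?expR_ge0// mulrC.
    by rewrite [leLHS]p1 ge0_ler_powR ?nnegrE// ?ltW//; lra.
  by rewrite /mass_constant mulrDl; have := mulr_ge0 C1 dt0; lra.
have [d00|dN0] := eqVneq d 0 => small0.
  have c0 : 0 < 2^-1 - delta by rewrite subr_gt0.
  have [A HA] := expR_eventually_small (expR ((2^-1 - delta) * L 0)) c0 e0.
  pose n := (Num.truncn (expR A)).+1.
  have An : A <= L n.
    rewrite -ler_expR -qE ltW//; apply: lt_le_trans (truncnS_gt _) _.
    by rewrite ler_nat q_ge.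
  exists n.+1; apply: le_trans (narrow n 1 _ _ _) _ => //; first by rewrite d00 mul0r.
    by move=> z; exact: mass_le1.
  rewrite d00 powR0 ?gt_eqF// mulr0 add0r; apply: le_trans (HA _ An).
  rewrite -expRD (_ : _ + _ = - ((2^-1 - delta) * (L n - L 0))); last by ring.
  rewrite mul1r expRN lef_pV2 ?posrE ?expR_gt0 ?prod_digit_count//.
  by apply: lt_le_trans (prod_digit_count n); exact: expR_gt0.
have dpos : 0 < d by rewrite lt0r dN0.
have ex : exists n, 1 <= d * (4 * expR (L n)).
  exists (Num.truncn d^-1).+1; rewrite -ler_pdivrMl// mulr1 -qE.
  apply: le_trans (ltW (truncnS_gt _)) _; rewrite -natrM ler_nat.
  by apply: leq_trans (q_ge _) _; rewrite leq_pmull.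
case: (ex_minnP ex) => -[|n] hn nmin; first by rewrite leNgt small0 in hn.
have {}nmin : d * (4 * expR (L n)) < 1.
  by rewrite ltNge; apply/negP => /nmin; rewrite ltnn.
(* This is 8 d q_(n+1) / y_n, a bound on the touched proportion at level n. As [t <= 1], the minimum
   of z and 1 is at most z^t. *)
pose z := 8 * d * expR (theta * L n + (L n + L n.+1) / 2).
have z0 : 0 < z by rewrite !mulr_gt0// expR_gt0.
exists n.+1; apply: le_trans (narrow n (z `^ t) _ nmin _) _.
- exact: powR_ge0.
- move=> v; have [z1|z1] := leP 1 z.
    apply: le_trans (mass_le1 _ _ ncg _ _ _ _) _.
    by rewrite [leLHS]p1 ge0_ler_powR ?nnegrE// ?ltW.
  apply: (@le_trans _ _ z); last first.
    by rewrite -[leLHS]powRr1 ?(ltW z0)// ger_powR// z0 ltW.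
  pose V := Num.truncn (2 * expR (L n.+1) * d + 2^-1).
  apply: le_trans (@mass1_count _ _ _ _ ncg U n v V _) _.
    move=> m m' _ _ mm' h h'; rewrite -leq_subLR /V truncn_ge_nat.
      exact: (touched_digits Ud mm' h h').
    by rewrite addr_ge0// !mulr_ge0// expR_ge0.
  (* With u = d q_(n+1) >= 1/4, the additive constant is absorbed: 2u + 3/2 <= 8u. *)
  have V8 : V.+1%:R <= 8 * expR (L n.+1) * d.
    have : V%:R <= 2 * expR (L n.+1) * d + 2^-1.
      by rewrite truncn_le addr_ge0// !mulr_ge0// expR_ge0.
    have -> : V.+1%:R = V%:R + 1 :> R by rewrite natr1.
    lra.
  apply: (@le_trans _ _ (8 * expR (L n.+1) * d / y n)).
    apply: ler_pM => //; rewrite lef_pV2 ?posrE ?ltr0n ?expR_gt0//.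
    exact: digit_count_lb.
  rewrite /y -expRN /z.
  have -> : theta * L n + (L n + L n.+1) / 2 = L n.+1 + - (- (theta * L n) + (L n.+1 - L n) / 2) by lra.
  by rewrite expRD le_eqVlt; apply/orP; left; apply/eqP; ring.
have P0 : 0 < \prod_(i < n) (nc i)%:R :> R by apply: lt_le_trans (prod_digit_count n); exact: expR_gt0.
rewrite ler_pdivrMr//.
(* After [L n.+1 <= w * L n], comparing exponents is exactly [tw] multiplied by [L n]. *)
have main : z `^ t <= 8 `^ t * d `^ t * expR ((2^-1 - delta) * L n).
  rewrite /z powRM ?expR_ge0 ?mulr_ge0// powRM// ler_wpM2l ?mulr_ge0 ?powR_ge0//.
  rewrite -expRM ler_expR.
  have h1 : t * L n.+1 <= t * (w * L n) by rewrite ler_wpM2l// ltW.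
  have := ler_wpM2r (L0 n) tw; lra.
apply: le_trans main _.
apply: (@le_trans _ _ (8 `^ t * expR ((2^-1 - delta) * L 0) * d `^ t * expR ((2^-1 - delta) * (L n - L 0)))).
  have -> : (2^-1 - delta) * L n = (2^-1 - delta) * L 0 + (2^-1 - delta) * (L n - L 0) by ring.
  by rewrite expRD le_eqVlt; apply/orP; left; apply/eqP; ring.
apply: ler_pM; rewrite ?expR_ge0 ?mulr_ge0 ?powR_ge0 ?expR_ge0 ?prod_digit_count//.
by rewrite /mass_constant mulrDl; have := mulr_ge0 C2 dt0; lra.
Qed.

(** * Points of the Cantor set belong to Omega *)

Hypothesis alpha_lo : r 0 < alpha.
Hypothesis alpha_hi : alpha + r 0 < 1.

Lemma digit_scale_q k : y k * expR (L k) * 32 <= expR (L k.+1).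
Proof.
have yL : 0 <= y k * expR (L k) by rewrite mulr_ge0 ?expR_ge0.
apply: le_trans (ler_wpM2l yL (gap32 k)) _.
rewrite -!expRD ler_expR.
by have := mulr_ge0 (ltW theta_gt0) (L0 k); lra.
Qed.

Section Expansion.
Variables (m : nat -> nat) (g : R).
Hypothesis m_lt : forall k, (m k < nc k)%N.
Hypothesis g_close : forall k,
  `|g - (alpha + \sum_(i < k) (m i).+1%:R * D i)| <= r k.

Let j k : nat := (\sum_(i < k) (m i).+1 * q i).+1.

Lemma expansion_index_step k : j k.+1 = (j k + (m k).+1 * q k)%N.
Proof. by rewrite /j big_ord_recr /= addSn. Qed.

Lemma expansion_close k : dnint ((j k)%:R * alpha - g) <= r k.
Proof.
apply: le_trans (dnint_le _ (\sum_(i < k) (m i).+1 * p i)%N%:Z) _.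
suff E : alpha + \sum_(i < k) (m i).+1%:R * D i =
    (j k)%:R * alpha - (\sum_(i < k) (m i).+1 * p i)%N%:R.
  by have := g_close k; rewrite E distrC addrAC.
elim: k => [|k IH]; first by rewrite /j !big_ord0; ring.
rewrite big_ord_recr /= addrA IH expansion_index_step [in RHS]big_ord_recr /=.
by rewrite !natrD !natrM; ring.
Qed.

(** From j_k <= q_k follows j_(k+1) <= q_k + 2 y_k q_k <= 3 y_k q_k, and [digit_scale_q] bounds this
    by q_(k+1), which closes the induction. *)
Lemma expansion_index_ub k : (j k)%:R <= expR (L k) /\
  (j k.+1)%:R <= 3 * (y k * expR (L k)).
Proof.
have step i : (j i)%:R <= expR (L i) -> (j i.+1)%:R <= 3 * (y i * expR (L i)).
  move=> h; rewrite expansion_index_step natrD natrM qE.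
  have : (m i).+1%:R * expR (L i) <= 2 * y i * expR (L i).
    rewrite ler_wpM2r ?expR_ge0//; apply: le_trans (digit_count_ub i).
    by rewrite ler_nat.
  have : expR (L i) <= y i * expR (L i).
    by rewrite ler_peMl ?expR_ge0// digit_scale_ge1.
  lra.
suff h : (j k)%:R <= expR (L k) by split=> //; exact: step.
elim: k => [|k IH]; first by rewrite /j big_ord0 -expR0 ler_expR.
apply: le_trans (step _ IH) _; have := digit_scale_q k.
by have := mulr_ge0 (expR_ge0 (- (theta * L k) + (L k.+1 - L k) / 2)) (expR_ge0 (L k)); rewrite -/(y k); lra.
Qed.

Lemma expansion_index_gt k : (k < j k)%N.
Proof.
elim: k => [|k IH] //; rewrite expansion_index_step.
have := q_ge k; rewrite mulSn.
have : (0 < q k)%N by rewrite -(ltr_nat R) qE expR_gt0.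
by lia.
Qed.

(** The left side is at most 12 y_k^2 q_k / q_(k+1). The factor q_k^(-theta) in y_k serves to make
    this summable. *)
Lemma expansion_block k : r k * (j k.+1)%:R <= 12 * expR (- (2 * theta * L k)).
Proof.
have [_ h] := expansion_index_ub k.
apply: le_trans (ler_wpM2l (node_radius_ge0 k) h) _.
rewrite node_radiusE le_eqVlt; apply/orP; left; apply/eqP.
have -> : 4 * (y k * expR (- L k.+1)) * (3 * (y k * expR (L k))) =
  12 * (y k * y k * (expR (- L k.+1) * expR (L k))) by ring.
by rewrite -!expRD; congr (12 * expR _); lra.
Qed.

(* The index j k <= q k witnesses dist <= r k for the whole block of scales
   [j k, j k.+1), and r k * j k.+1 is summable, which bounds the sum of any
   monotone psi that g misses. *)
Lemma expansion_Omega : Omega11 alpha g.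
Proof.
have g01 : 0 <= g < 1.
  have := g_close 0; rewrite big_ord0 addr0 ler_norml => /andP[? ?].
  by have := alpha_lo; have := alpha_hi => ? ?; apply/andP; split; lra.
split => // psi [psi0 [psidec psioo]]; split => /=; first by have := alpha_lo; have := node_radius_ge0 0; have := alpha_hi => ? ? ?; apply/andP; split; lra.
split => //; apply: (@unbounded_infinite _ absz) => B; apply: contrapT => noq.
have far n : (B <= n)%N -> psi n <= dnint (n%:R * alpha - g).
  move=> Bn; rewrite leNgt; apply/negP => h; apply: noq.
  by exists n%:Z.
pose S n := \sum_(1 <= i < n) psi i.
(* The second term is a reserve for the remaining blocks: by [gap2] the exponential halves at each
   step, so 24 pays for the block cost 12 and for the next reserve. *)
pose C := S (j B) + 24 * expR (- (2 * theta * L B)).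
have bound n : S (j (B + n)%N) + 24 * expR (- (2 * theta * L (B + n)%N)) <= C.
  elim: n => [|n IH]; first by rewrite addn0.
  rewrite addnS; apply: le_trans IH; set k := (B + n)%N.
  have jj : (j k <= j k.+1)%N by rewrite expansion_index_step leq_addr.
  have -> : S (j k.+1) = S (j k) + \sum_(j k <= i < j k.+1) psi i.
    by rewrite /S (@big_cat_nat _ _ _ (j k)).
  have h1 : \sum_(j k <= i < j k.+1) psi i <= r k * (j k.+1)%:R.
    apply: (@le_trans _ _ (\sum_(j k <= i < j k.+1) r k)).
      rewrite !big_nat; apply: ler_sum => i /andP[ji _].
      apply: le_trans (psidec _ _ _ ji) _ => //.
      apply: le_trans (expansion_close k); apply: far.
      by apply: leq_trans (ltnW (expansion_index_gt k)); rewrite leq_addr.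
    rewrite sumr_const_nat -[leLHS]mulr_natr ler_wpM2l ?node_radius_ge0// ler_nat.
    exact: leq_subr.
  have h2 : expR (- (2 * theta * L k.+1)) <= expR (- (2 * theta * L k)) / 2.
    rewrite ler_pdivlMr//; apply: le_trans (ler_wpM2l (expR_ge0 _) (gap2 k)) _.
    by rewrite -expRD ler_expR; lra.
  by have := expansion_block k; lra.
move/cvgryPge : psioo => /(_ (C + 1))[n _ /(_ (j (B + n)%N))] /=.
rewrite (leq_trans _ (ltnW (expansion_index_gt _))) ?leq_addl// => /(_ isT).
have := bound n; have := expR_ge0 (- (2 * theta * L (B + n)%N)).
by rewrite /S; lra.
Qed.

End Expansion.

Lemma Omega11_not_null : hausdorff_measure t (Omega11 alpha) <> 0%E.
Proof.
move=> H0.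
have C0 : 0 < mass_constant.
  apply: lt_le_trans (_ : (4 * expR (L 0)) `^ t <= _).
    by rewrite powR_gt0// mulr_gt0// expR_gt0.
  by rewrite lerDr mulr_ge0// ?powR_ge0 ?expR_ge0.
(* The cover contributes mass less than 1/4 and the errors chosen below sum to 1/2, so the total
   stays below 1. *)
have [|U [d [OU d0 Ud sd]]] := @hausdorff_cover R t (Omega11 alpha) (4 * mass_constant)^-1 H0.
  by rewrite invr_gt0 mulr_gt0.
have /choice[N HN] : forall i, exists N : nat,
    mass (U i) N 0 alpha <= mass_constant * d i `^ t + 2^-1 / (2 ^ i.+1)%:R.
  move=> i; apply: (mass_diam_le _ (d0 i) _ (Ud i)).
  by rewrite divr_gt0// ltr0n expn_gt0.
have ncg k : (0 < nc k)%N by [].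
have [|m [g [mn gm gU]]] := @avoid R (fun k => D k) r nc ncg node_radius_ge0 digit_step_nested U N alpha.
  apply: (@le_lt_trans _ _ (\sum_(0 <= i <oo) (mass_constant%:E * (d i `^ t)%:E + (2^-1 / (2 ^ i.+1)%:R)%:E))%E).
    apply: lee_nneseries => [i _ _|i _]; last by rewrite -EFinM -EFinD lee_fin.
    by rewrite lee_fin mass_ge0.
  have h i : (0 <= mass_constant%:E * (d i `^ t)%:E)%E.
    by rewrite -EFinM lee_fin mulr_ge0 ?powR_ge0// ltW.
  apply: le_lt_trans (@epsilon_trick R _ _ predT h _) _; first by rewrite invr_ge0.
  rewrite nneseriesZl; last by move=> i _; rewrite lee_fin powR_ge0.
  have s0 : (0 <= \sum_(0 <= i <oo) (d i `^ t)%:E)%E.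
    by apply: nneseries_ge0 => i _ _; rewrite lee_fin powR_ge0.
  case: (\sum_(0 <= i <oo) _)%E s0 sd => // s; rewrite lee_fin lte_fin => s0 sd.
  rewrite -EFinM -EFinD lte_fin.
  have : mass_constant * s < mass_constant * (4 * mass_constant)^-1 by rewrite ltr_pM2l.
  rewrite invfM mulrCA divff ?gt_eqF//; lra.
by have [i _ Ui] := OU g (expansion_Omega mn gm); exact: gU Ui.
Qed.

End LowerBound.

(** * Dimensions *)

Section Dimension.
Variable R : realType.
Implicit Types (alpha s t c : R) (E : set R).

Definition approx_exponent alpha : set R := [set s | 0 < s /\
  infinite_set [set q : nat | (0 < q)%N /\ dnint (q%:R * alpha) < q%:R `^ (- s)]].

Lemma approx_exponent1 alpha : 0 <= alpha < 1 -> irrational alpha ->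
  approx_exponent alpha 1.
Proof.
move=> a01 irr; have [Q [P [cv _]]] := cf_convergents a01 irr.
split => //; apply: (@unbounded_infinite _ id) => B.
exists (Q B); last exact: (conv_ge cv B).
split; first exact: (conv_gt0 cv B).
rewrite powR_inv1//; apply: le_lt_trans (dnint_le _ (P B)%:Z) _.
apply: lt_le_trans (conv_ub cv B) _.
by rewrite lef_pV2 ?posrE ?ltr0n ?(conv_gt0 cv)// ler_nat (conv_le cv).
Qed.

Lemma irr_exp_ge1 alpha : approx_exponent alpha 1 -> (1%:E <= irr_exp alpha)%E.
Proof. by move=> h; apply: ereal_sup_ubound; exists 1. Qed.

Lemma dimH_le E t : 0 < t -> hausdorff_measure t E = 0%E -> (dimH E <= t%:E)%E.
Proof. by move=> t0 Et; apply: ereal_inf_lbound; exists t. Qed.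

(** Whenever c/t - 1 is below the irrationality exponent, some approximation exponent [s] has
    [c < t * (1 + s)]. Then [t] decreases to c/(w+1), or to 0 when w is infinite. *)
Lemma dimH_le_div_w1 alpha c E : 0 < c -> approx_exponent alpha 1 ->
  (forall s t, approx_exponent alpha s -> 0 < t -> c < t * (1 + s) ->
     hausdorff_measure t E = 0%E) ->
  (dimH E <= div_w1 c (irr_exp alpha))%E.
Proof.
move=> c0 /irr_exp_ge1 w1 H.
have key t : 0 < t -> ((c / t - 1)%:E < irr_exp alpha)%E -> (dimH E <= t%:E)%E.
  move=> t0 /ereal_sup_gt[_ [s As <-]]; rewrite lte_fin => hs.
  apply: dimH_le => //; apply: (H s) => //.
  by move: hs; rewrite ltrBlDl ltr_pdivrMr// mulrC.
case: (irr_exp alpha) w1 key => [w||] //=; rewrite ?lee_fin => w1 key.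
  have w0 : 0 < w + 1 by lra.
  apply/lee_addgt0Pr => e e0; rewrite -EFinD; apply: key.
    by rewrite addr_gt0// divr_gt0.
  rewrite lte_fin ltrBlDr ltr_pdivrMr; last by rewrite addr_gt0// divr_gt0.
  rewrite mulrDr mulrCA divff ?gt_eqF// mulr1 ltrDl; exact: mulr_gt0.
apply/lee_addgt0Pr => e e0; rewrite add0e; apply: key => //.
exact: ltry.
Qed.

Lemma div_w1_le_dimH alpha E : approx_exponent alpha 1 ->
  (forall w t, (irr_exp alpha < w%:E)%E -> 0 < t -> t * (1 + w) < 1 ->
     hausdorff_measure t E <> 0%E) ->
  (div_w1 1 (irr_exp alpha) <= dimH E)%E.
Proof.
move=> /irr_exp_ge1 w1 H; apply: le_ereal_inf_tmp => _ [t [t0 Et] <-].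
case: (irr_exp alpha) w1 H => [w||] //=; rewrite ?lee_fin => w1 H; last exact: ltW.
have w0 : 0 < w + 1 by lra.
rewrite leNgt; apply/negP; rewrite ltr_pdivlMr// => tw.
have [w' [ww' tw']] : exists w', w < w' /\ t * (1 + w') < 1.
  have h : w < t^-1 - 1 by rewrite ltrBrDr -(ltr_pM2l t0) divff ?gt_eqF.
  (* The strict inequality t(w+1) < 1 leaves room between w and 1/t - 1; the midpoint is taken. *)
  exists ((w + (t^-1 - 1)) / 2); split; first by lra.
  rewrite -(ltr_pM2l t0) in h.
  have : t * t^-1 = 1 by rewrite divff ?gt_eqF.
  by lra.
by apply: (H w' t) => //; rewrite lte_fin.
Qed.

Lemma lacunary_growth alpha Q P :
  convergents alpha Q P -> (forall k, cf_q alpha k = (Q k)%:R) ->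
  (1%:E < limn_einf (fun k => (ln (cf_q alpha k.+1) / ln (cf_q alpha k))%:E))%E ->
  exists2 eta : R, 0 < eta & exists K0, forall k, (K0 <= k)%N ->
    (1 + eta) * log_conv R Q k <= log_conv R Q k.+1.
Proof.
move=> cv QE; set u := fun k => _.
rewrite limn_einf_lim (cvg_lim _ (@cvg_einfs_sup _ u))// => /ereal_sup_gt[_ [n _ <-]] h.
have [c c1 cu] : exists2 c : R, 1 < c & forall k, (n <= k)%N -> (c%:E <= u k)%E.
  have inf_le k : (n <= k)%N -> (einfs u n <= u k)%E.
    by move=> nk; apply: ereal_inf_lbound; exists k.
  case: (einfs u n) h inf_le => [c||]//; first by rewrite lte_fin; exists c.
  move=> _ inf_le; exists 2; first by rewrite ltr1n.
  by move=> k /inf_le; rewrite leye_eq => /eqP.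
exists (c - 1); first by rewrite subr_gt0.
(* From index 2 on [Q k >= 2], so the logarithm in the denominator is positive. *)
exists (maxn n 2) => k; rewrite geq_max => /andP[nk k2].
have := cu k nk; rewrite /u !QE lee_fin addrC subrK ler_pdivlMr//.
by rewrite ln_gt0// ltr1n; apply: leq_trans k2 (conv_ge cv k).
Qed.

Lemma Omega11_null_uniform alpha t : 0 < t ->
  (forall N0, hnull t (uniformly_approximable alpha N0)) ->
  hausdorff_measure t (Omega11 alpha) = 0%E.
Proof.
move=> t0 H; apply: hnull_hausdorff => //.
exact: hnull_sub (@Omega11_uniform _ alpha) (hnull_bigcup H).
Qed.

Lemma dimH_Omega11_le2 alpha : 0 <= alpha < 1 -> irrational alpha ->
  (dimH (Omega11 alpha) <= div_w1 2 (irr_exp alpha))%E.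
Proof.
move=> a01 irr; have A1 := approx_exponent1 a01 irr.
apply: dimH_le_div_w1 => // s t As t0 ts.
apply: Omega11_null_uniform => // N0.
(* An exponent below 1 is replaced by 1, which is always available and only weakens the condition on
   [t]. *)
have [s1|s1] := leP 1 s.
  by case: As => _; exact: uniformly_approximable_null.
case: A1 => _; apply: uniformly_approximable_null => //.
by apply: lt_trans ts _; rewrite ltr_pM2l// ltrD2l.
Qed.

Lemma dimH_Omega11_lacunary_le alpha eta Q P K0 :
  convergents alpha Q P -> 0 < eta -> approx_exponent alpha 1 ->
  (forall k, (K0 <= k)%N -> (1 + eta) * log_conv R Q k <= log_conv R Q k.+1) ->
  (dimH (Omega11 alpha) <= div_w1 1 (irr_exp alpha))%E.
Proof.
move=> cv eta0 A1 growth; apply: dimH_le_div_w1 => // s t [s0 infs] t0 ts.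
apply: Omega11_null_uniform => // N0.
apply: (uniformly_approximable_null_lacunary cv eta0 growth) ts _ => //.
exact: (convergents_infinite cv eta0 growth).
Qed.

(** Above the irrationality exponent, ||q alpha|| >= q^(-w) for all large q; at q = Q k this meets
    the upper bound 1/Q k.+1. *)
Lemma convergents_log_ub alpha Q P w : convergents alpha Q P ->
  0 < w -> (irr_exp alpha < w%:E)%E ->
  exists K, forall k, (K <= k)%N -> log_conv R Q k.+1 <= w * log_conv R Q k.
Proof.
move=> cv w0 irrw.
have [K HK] : exists K, forall q, (K <= q)%N -> (0 < q)%N ->
    q%:R `^ (- w) <= dnint (q%:R * alpha).
  apply: contrapT => H; move: irrw; rewrite ltNge => /negP; apply.
  apply: ereal_sup_ubound; exists w => //; split => //.
  apply: (@unbounded_infinite _ id) => B; apply: contrapT => H'.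
  apply: H; exists B => q Bq q0; rewrite leNgt; apply/negP => hq.
  by apply: H'; exists q.
exists K => k Kk; have := HK _ (leq_trans Kk (conv_ge cv k)) (conv_gt0 cv k).
move=> /le_trans/(_ (dnint_le _ (P k)%:Z))/le_lt_trans/(_ (conv_ub cv k)).
rewrite !(ln_convK cv) -expRM -expRN ltr_expR => /ltW; lra.
Qed.

Lemma dimH_Omega11_lacunary_ge alpha eta Q P K0 : 0 <= alpha < 1 ->
  irrational alpha -> convergents alpha Q P -> 0 < eta -> approx_exponent alpha 1 ->
  (forall k, (K0 <= k)%N -> (1 + eta) * log_conv R Q k <= log_conv R Q k.+1) ->
  (div_w1 1 (irr_exp alpha) <= dimH (Omega11 alpha))%E.
Proof.
move=> /andP[a0 a1] irr cv eta0 A1 growth.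
apply: div_w1_le_dimH => // w t irrw t0 tw.
have w0 : 0 < w.
  by have := le_lt_trans (irr_exp_ge1 A1) irrw; rewrite lte_fin; lra.
have [K1 HK1] := convergents_log_ub cv w0 irrw.
have alpha0 : 0 < alpha by rewrite lt0r irrational_neq0.
(* Chosen so that delta + theta is half of the slack 1 - t(1+w); with t <= 1 this gives the exponent
   inequality of the mass estimate. *)
pose delta := (1 - t * (1 + w)) / (2 * (1 + eta)).
have delta0 : 0 < delta by rewrite divr_gt0 ?mulr_gt0; lra.
have deltaE : delta + eta * delta = (1 - t * (1 + w)) / 2.
  by rewrite /delta; field; rewrite gt_eqF//; lra.
have t_le1 : t <= 1.
  by have := mulr_gt0 t0 w0; lra.
have theta0 : 0 < eta * delta by rewrite mulr_gt0.
pose m := Num.min alpha (1 - alpha).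
have m0 : 0 < m by rewrite lt_min alpha0 subr_gt0.
have [A3 HA3] := expR_eventually_small 4 ltr01 (divr_gt0 m0 (ltr0n R 2)).
(* [A3] fits the root interval into (0,1); the other two bounds give the gap conditions with
   constants 32 and 2. *)
pose A := Num.max A3 (Num.max (2 * ln 32) (ln 2 / (2 * (eta * delta)))).
have [K2 HK2] := ln_conv_large cv eta0 growth A.
(* The tree is built on the convergents from [K] on, where all estimates hold. *)
pose K := maxn K1 K2.
have LK k : [/\ A3 <= log_conv R Q (K + k),
    2 * ln 32 <= log_conv R Q (K + k.+1) - log_conv R Q (K + k),
    ln 2 / (2 * (eta * delta)) <= log_conv R Q (K + k.+1) - log_conv R Q (K + k),
    eta * log_conv R Q (K + k) <= log_conv R Q (K + k.+1) - log_conv R Q (K + k)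
  & log_conv R Q (K + k.+1) <= w * log_conv R Q (K + k)].
  have K1k : (K1 <= K + k)%N by apply: leq_trans (leq_addr _ _); exact: leq_maxl.
  have K2k : (K2 <= K + k)%N by apply: leq_trans (leq_addr _ _); exact: leq_maxr.
  have [K0k] := HK2 _ K2k; rewrite addnS {1}/A ge_max => /andP[h1 _].
  rewrite /A !ge_max => /and3P[_ h2 h3]; split => //; last exact: HK1.
  by have := growth _ K0k; lra.
pose L k := log_conv R Q (K + k).
have exp_ln (x : R) : 0 < x -> x = expR (ln x) by move=> x0; rewrite lnK.
have r0 : node_radius eta delta L 0 < m.
  apply: (@le_lt_trans _ _ (m / 2)); last by lra.
  apply: le_trans (HA3 (L 0%N) _); last by have [] := LK 0%N.
  rewrite /node_radius ler_pM2l// ler_expR mul1r.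
  have := mulr_ge0 (ltW theta0) (ln_conv_ge0 cv (K + 0)%N).
  have [_ h _ _ _] := LK 0%N; have : 0 <= ln 32 :> R by rewrite ln_ge0// ler1n.
  rewrite -/(L 0%N) -/(L 1%N) in h *; lra.
move: r0; rewrite lt_min => /andP[r0 r1].
apply: (@Omega11_not_null R alpha eta delta (fun k => Q (K + k)%N)
  (fun k => P (K + k)%N) L _ _ _ _ eta0 delta0 _ _ _ _ _ w t) => //.
- by move=> k; exact: ln_convK cv _.
- by move=> k; apply: leq_trans (conv_ge cv _); exact: leq_addl.
- move=> k; rewrite /L addnS expRN -(ln_convK cv) ltW//; exact: conv_ub cv _.
- by move=> k; rewrite /L addnS expRN -(ln_convK cv) -invfM mulrC; exact: (conv_lb cv).
- by have := mulr_gt0 eta0 delta0; have := mulr_gt0 t0 w0; lra.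
- by move=> k; exact: ln_conv_ge0 cv _.
- by move=> k; have [] := LK k.
- move=> k; have [_ h _ _ _] := LK k.
  by rewrite [leLHS]exp_ln// ler_expR /L; lra.
- move=> k; have [_ _ h _ _] := LK k.
  rewrite [leLHS]exp_ln// ler_expR mulrC -ler_pdivrMr//.
  exact: (mulr_gt0 (ltr0n R 2) theta0).
- by move=> k; have [] := LK k.
- have : t * (eta * delta) <= eta * delta by rewrite ler_piMl// ltW.
  by lra.
- by lra.
Qed.

End Dimension.

Theorem theorem1p5 (R : realType) :
  (forall alpha : R, 0 <= alpha < 1 -> irrational alpha ->
     (dimH (Omega11 alpha) <= div_w1 2 (irr_exp alpha))%E) /\
  (forall alpha : R, 0 <= alpha < 1 -> irrational alpha ->
     (1%:E < limn_einf (fun k => (ln (cf_q alpha k.+1) / ln (cf_q alpha k))%:E))%E ->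
     dimH (Omega11 alpha) = div_w1 1 (irr_exp alpha)).
Proof.
split=> alpha a01 irr; first exact: dimH_Omega11_le2.
have A1 := approx_exponent1 a01 irr.
have [Q [P [cv QE]]] := cf_convergents a01 irr.
move=> /(lacunary_growth cv QE)[eta eta0 [K0 growth]].
apply/eqP; rewrite eq_le (dimH_Omega11_lacunary_le cv eta0 A1 growth).
exact: (dimH_Omega11_lacunary_ge a01 irr cv eta0 A1 growth).
Qed.
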